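(* Consider the linear Gaussian state-space model of the context and fix $l\ge0$. Let the matrices $\boldsymbol{P}_{i,i+1}$, $i=0,\dots,l$, be constructed recursively by $$\boldsymbol{P}_{i,i+1}=\begin{bmatrix}\boldsymbol{G}_i&\boldsymbol{F}_i\end{bmatrix}\boldsymbol{J}_i^{-1}\begin{bmatrix}\boldsymbol{G}_i^T\\ \boldsymbol{F}_i^T\end{bmatrix},\qquad i=0,\dots,l,$$ where $$\boldsymbol{J}_0=\begin{bmatrix}\boldsymbol{Q}_0^{-1}&\boldsymbol{0}\\ \boldsymbol{0}&\boldsymbol{H}_0^T\boldsymbol{R}_0^{-1}\boldsymbol{H}_0+\boldsymbol{\Pi}_0^{-1}\end{bmatrix},\qquad \boldsymbol{J}_i=\begin{bmatrix}\boldsymbol{Q}_i^{-1}&\boldsymbol{0}\\ \boldsymbol{0}&\boldsymbol{H}_i^T\boldsymbol{R}_i^{-1}\boldsymbol{H}_i+\boldsymbol{P}_{i-1,i}^{-1}\end{bmatrix},\quad i=1,\dots,l.$$ Then these matrices are related to the covariance matrices $\boldsymbol{D}_i$, $i\ge1$, of the Kalman filter by $$\boldsymbol{D}_{i+1}=\boldsymbol{P}_{i,i+1},\qquad i=0,\dots,l.$$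
   Context: State-space model. $\boldsymbol{z}_{l+1}=\boldsymbol{F}_l\boldsymbol{z}_l+\boldsymbol{G}_l\boldsymbol{u}_l$ and $\boldsymbol{y}_l=\boldsymbol{H}_l\boldsymbol{z}_l+\boldsymbol{v}_l$ for $l\ge0$, with known real matrices $\boldsymbol{F}_l$ ($n\times n$), $\boldsymbol{G}_l$ ($n\times r$), $\boldsymbol{H}_l$ ($q\times n$), where each $[\boldsymbol{F}_l\ \boldsymbol{G}_l]$ has full row rank. $\{\boldsymbol{u}_l\}$ and $\{\boldsymbol{v}_l\}$ are zero-mean white Gaussian processes, mutually uncorrelated (hence, jointly Gaussian, independent), with $E[\boldsymbol{u}_l\boldsymbol{u}_j^T]=\boldsymbol{Q}_l\delta_{lj}$, $E[\boldsymbol{v}_l\boldsymbol{v}_j^T]=\boldsymbol{R}_l\delta_{lj}$, $E[\boldsymbol{u}_l\boldsymbol{v}_j^T]=\boldsymbol{0}$, $\boldsymbol{Q}_l\succ0$, $\boldsymbol{R}_l\succ0$. $\boldsymbol{z}_0$ is Gaussian with zero mean and covariance $\boldsymbol{\Pi}_0\succ0$, independent of $\{\boldsymbol{u}_l\}$ and $\{\boldsymbol{v}_l\}$. Kalman filter covariance matrices. With $\hat{\boldsymbol{z}}_{l+1|l}^\star=E[\boldsymbol{z}_{l+1}\mid\boldsymbol{y}_0,\dots,\boldsymbol{y}_l]$ and $\hat{\boldsymbol{z}}_{0|-1}^\star=\boldsymbol{0}$, $\boldsymbol{D}_l=E[(\boldsymbol{z}_l-\hat{\boldsymbol{z}}_{l|l-1}^\star)(\boldsymbol{z}_l-\hat{\boldsymbol{z}}_{l|l-1}^\star)^T]$.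 The Kalman filter computes them by $\boldsymbol{D}_0=\boldsymbol{\Pi}_0$ and, for $l\ge0$, $$\boldsymbol{K}_l=\boldsymbol{F}_l\boldsymbol{D}_l\boldsymbol{H}_l^T(\boldsymbol{H}_l\boldsymbol{D}_l\boldsymbol{H}_l^T+\boldsymbol{R}_l)^{-1},\qquad \boldsymbol{D}_{l+1}=\boldsymbol{F}_l\boldsymbol{D}_l\boldsymbol{F}_l^T+\boldsymbol{G}_l\boldsymbol{Q}_l\boldsymbol{G}_l^T-\boldsymbol{K}_l(\boldsymbol{H}_l\boldsymbol{D}_l\boldsymbol{H}_l^T+\boldsymbol{R}_l)\boldsymbol{K}_l^T.$$ Origin of $\boldsymbol{P}_{i,i+1}$. These are the weighting matrices of the primal-dual method of multipliers for the quadratic problem $\min\sum_{i=0}^l g_i(\boldsymbol{z}_i,\boldsymbol{u}_i)$ s.t. $\boldsymbol{z}_{i+1}=\boldsymbol{F}_i\boldsymbol{z}_i+\boldsymbol{G}_i\boldsymbol{u}_i$ ($i=0,\dots,l$) on the chain graph with nodes $0,\dots,l+1$, where $g_i(\boldsymbol{z}_i,\boldsymbol{u}_i)=\frac12\boldsymbol{u}_i^T\boldsymbol{Q}_i^{-1}\boldsymbol{u}_i+\frac12(\boldsymbol{y}_i-\boldsymbol{H}_i\boldsymbol{z}_i)^T\boldsymbol{R}_i^{-1}(\boldsymbol{y}_i-\boldsymbol{H}_i\boldsymbol{z}_i)$, with the extra term $\frac12\boldsymbol{z}_0^T\boldsymbol{\Pi}_0^{-1}\boldsymbol{z}_0$ for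 $i=0$; all inverses above exist under the stated assumptions. *)

(* Defs.v *)
From HB Require Import structures.
From mathcomp Require Import all_boot all_order all_algebra.
From mathcomp Require Import all_classical all_reals all_analysis.

Set Implicit Arguments.
Unset Strict Implicit.
Unset Printing Implicit Defensive.
Import Order.TTheory GRing.Theory Num.Theory.
Import numFieldNormedType.Exports.

Local Open Scope classical_set_scope.
Local Open Scope ring_scope.

Definition posdefmx (R : realType) (n : nat) (A : 'M[R]_n) : Prop :=
  A^T = A /\ forall x : 'cV[R]_n, x != 0 -> 0 < (x^T *m A *m x) 0 0.

Definition coord (R : realType) (T : Type) (n : nat) (x : T -> 'cV[R]_n)
    (i : 'I_n) : T -> R :=
  fun w => x w i 0.

Section Probability.
Context (d : measure_display) (T : measurableType d) (R : realType).
Variable P : probability T R.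

(* [fine] sends a non-finite expectation to 0; below, it is only applied to
   integrable entries. *)
Definition expectation_mx (m n : nat) (X : T -> 'M[R]_(m, n)) : 'M[R]_(m, n) :=
  \matrix_(i, j) fine ('E_P[fun w => X w i j])%E.

(* Constants count as Gaussian. The Dirac case is separate because
   [normal_prob m 0] is by convention the uniform law on [0, 1]. *)
Definition gaussian (X : T -> R) : Prop :=
  measurable_fun [set: T] X /\
  ((exists m s : R, 0 < s /\
      forall A : set R, measurable A -> P (X @^-1` A) = normal_prob m s A) \/
   (exists m : R,
      forall A : set R, measurable A -> P (X @^-1` A) = \d_m A)).

Definition jointly_gaussian (I : Type) (X : I -> T -> R) : Prop :=
  forall (s : seq I) (c : I -> R), gaussian (fun w => \sum_(i <- s) c i * X i w).

(* The sigma-algebra generated by a family of real functions. *)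
Definition sigma_family (I : Type) (X : I -> T -> R) : set (set T) :=
  <<s \bigcup_(i in [set: I]) preimage_set_system [set: T] (X i) measurable >>.

Definition independent_families (I J : Type) (X : I -> T -> R)
    (Y : J -> T -> R) : Prop :=
  forall A B : set T, sigma_family X A -> sigma_family Y B ->
    P (A `&` B) = (P A * P B)%E.

(* [Y] is a version of the conditional expectation of [X] given the
   sub-sigma-algebra [S]. *)
Definition is_cond_expectation (S : set (set T)) (X Y : T -> R) : Prop :=
  [/\ forall B : set R, measurable B -> S (Y @^-1` B),
      P.-integrable [set: T] (EFin \o X),
      P.-integrable [set: T] (EFin \o Y)
    & forall A : set T, S A ->
        (\int[P]_(w in A) (Y w)%:E = \int[P]_(w in A) (X w)%:E)%E].

End Probability.

Record ssm_coef (R : realType) (n r q : nat) := SsmCoef {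
  ssm_F : nat -> 'M[R]_n;
  ssm_G : nat -> 'M[R]_(n, r);
  ssm_H : nat -> 'M[R]_(q, n);
  ssm_Q : nat -> 'M[R]_r;
  ssm_R : nat -> 'M[R]_q;
  ssm_Pi0 : 'M[R]_n }.

Definition ssm_coef_ok (R : realType) (n r q : nat) (c : ssm_coef R n r q) :
    Prop :=
  [/\ forall l, row_free (row_mx (ssm_F c l) (ssm_G c l)),
      forall l, posdefmx (ssm_Q c l),
      forall l, posdefmx (ssm_R c l)
    & posdefmx (ssm_Pi0 c)].

Section Model.
Context (d : measure_display) (T : measurableType d) (R : realType).
Variable P : probability T R.
Variables n r q : nat.

Definition process_entries (k : nat) (x : nat -> T -> 'cV[R]_k)
    (li : nat * 'I_k) : T -> R :=
  coord (x li.1) li.2.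

Definition noise_entries (u : nat -> T -> 'cV[R]_r) (v : nat -> T -> 'cV[R]_q)
    (e : (nat * 'I_r) + (nat * 'I_q)) : T -> R :=
  match e with
  | inl li => process_entries u li
  | inr li => process_entries v li
  end.

Record gaussian_ssm (c : ssm_coef R n r q) (z : nat -> T -> 'cV[R]_n)
    (y : nat -> T -> 'cV[R]_q) (u : nat -> T -> 'cV[R]_r)
    (v : nat -> T -> 'cV[R]_q) : Prop := GaussianSsm {
  ssm_state : forall l w,
    z l.+1 w = ssm_F c l *m z l w + ssm_G c l *m u l w;
  ssm_measurement : forall l w,
    y l w = ssm_H c l *m z l w + v l w;
  ssm_noise_gaussian : jointly_gaussian P (noise_entries u v);
  ssm_u_mean : forall l, expectation_mx P (u l) = 0;
  ssm_v_mean : forall l, expectation_mx P (v l) = 0;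
  ssm_u_cov : forall l j,
    expectation_mx P (fun w => u l w *m (u j w)^T) = ssm_Q c l *+ (l == j);
  ssm_v_cov : forall l j,
    expectation_mx P (fun w => v l w *m (v j w)^T) = ssm_R c l *+ (l == j);
  ssm_uv_cov : forall l j,
    expectation_mx P (fun w => u l w *m (v j w)^T) = 0;
  ssm_z0_gaussian : jointly_gaussian P (coord (z 0%N));
  ssm_z0_mean : expectation_mx P (z 0%N) = 0;
  ssm_z0_cov :
    expectation_mx P (fun w => z 0%N w *m (z 0%N w)^T) = ssm_Pi0 c;
  ssm_z0_indep :
    independent_families P (coord (z 0%N)) (noise_entries u v) }.

Definition past_measurements (y : nat -> T -> 'cV[R]_q) (l : nat) :
    set (set T) :=
  sigma_family (fun ji : 'I_l.+1 * 'I_q => coord (y ji.1) ji.2).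

(* [zhat l] is the one-step prediction of [z l] from [y 0, ..., y (l - 1)];
   a conditional expectation is determined only almost surely, hence a
   predicate. *)
Definition is_kalman_predictor (z : nat -> T -> 'cV[R]_n)
    (y : nat -> T -> 'cV[R]_q) (zhat : nat -> T -> 'cV[R]_n) : Prop :=
  (forall w, zhat 0%N w = 0) /\
  (forall l i, is_cond_expectation P (past_measurements y l)
                 (coord (z l.+1) i) (coord (zhat l.+1) i)).

Definition kalman_cov (z zhat : nat -> T -> 'cV[R]_n) (l : nat) : 'M[R]_n :=
  expectation_mx P (fun w => (z l w - zhat l w) *m (z l w - zhat l w)^T).

End Model.

Section Weights.
Context (R : realType) (n r q : nat).
Variable c : ssm_coef R n r q.

Definition weight_J (i : nat) (W : 'M[R]_n) : 'M[R]_(r + n) :=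
  block_mx (invmx (ssm_Q c i)) 0
           0 ((ssm_H c i)^T *m invmx (ssm_R c i) *m ssm_H c i + invmx W).

(* [pdmm_weight i] is P_{i,i+1}; Pi_0 plays the role of P_{-1,0}. *)
Fixpoint pdmm_weight (i : nat) : 'M[R]_n :=
  row_mx (ssm_G c i) (ssm_F c i)
  *m invmx (weight_J i (if i is j.+1 then pdmm_weight j else ssm_Pi0 c))
  *m col_mx (ssm_G c i)^T (ssm_F c i)^T.

End Weights.

(* Main.v *)
Require Import Defs.
From HB Require Import structures.
From mathcomp Require Import all_boot all_order all_algebra.
From mathcomp Require Import all_classical all_reals all_analysis.
From mathcomp Require Import measurable_realfun ring lra.

Set Implicit Arguments.
Unset Strict Implicit.
Unset Printing Implicit Defensive.
Import Order.TTheory GRing.Theory Num.Theory.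
Import numFieldNormedType.Exports.

Local Open Scope classical_set_scope.
Local Open Scope ring_scope.

(** The optimal one-step predictor is a conditional expectation, and for a
    Gaussian model it is the linear least-squares predictor.  The proof
    therefore exhibits a linear recursion [zlin] whose error covariance obeys
    the recursion that defines the weights, and shows that it is a version of
    the conditional expectation; versions agree almost surely, so the error
    covariance of any Kalman predictor is the weight.

    Matrix part.  Write W_0 = Pi_0 and W_(l+1) = P_(l,l+1).  Since J_l is block
    diagonal, W_(l+1) = G Q G^T + F N^-1 F^T with N = H^T R^-1 H + W_l^-1
    ([weightS]); the full row rank of [F G] keeps every W_l positive definite
    ([weight_posdef]).  With the gain K = F N^-1 H^T R^-1 one has
    F - K H = F N^-1 W_l^-1.  Hence the linear predictor with this gain leaves
    an error that is orthogonal to the new measurement ([gain_orth]) and has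
    covariance
      (F - K H) W_l (F - K H)^T + G Q G^T + K R K^T = W_(l+1)
    ([weight_riccati]).  An induction over time that uses only second moments
    ([mom2_err]) gives the error covariance W_l and the orthogonality of the
    error to all past measurements.

    Probabilistic part.  The entries of z_0 and of the noises generate a
    Gaussian space: each of its elements is a centred normal variable, because
    a sum of two independent centred normal variables is again one
    ([normal0_conv], [addspan_gaussian]).  In a Gaussian space, a variable [X]
    orthogonal to [W] satisfies E[X sin (W + b)] = 0 ([orth_sin]): a X + W and
    - a X + W have the same second moment, hence the same law, and comparing
    the expectations of their cosines and letting [a] tend to 0 gives the
    claim.  The sines generate, by linear combinations and bounded pointwise
    limits, the indicator of every event of the sigma-algebra of the variables
    [W] ([sigma_family_trig_closure_set]).  So the prediction error, orthogonal
    to the past measurements, integrates to 0 over every event that they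
    determine ([gaussian_orth_integral]), which is what makes the linear
    predictor a conditional expectation ([zlin_cond_expectation]). *)

(* Entries of a random vector, not coordinates in a basis. *)
Local Notation coord := Defs.coord.

(** * Laws of random variables and sums of independent variables *)

Section Laws.
Context (d : measure_display) (T : measurableType d) (R : realType).
Variable P : probability T R.
(* [lebesgue_measure] and [normal_prob] live on [measurableTypeR R], which has
   the measurable sets of [R] under another display. *)
Local Notation RB := (measurableTypeR R).

Definition has_law (nu : set RB -> \bar R) (X : T -> R) : Prop :=
  measurable_fun [set: T] X /\
  forall A : set R, measurable A -> P (X @^-1` A) = nu A.

Lemma ge0_integral_law (nu : {measure set RB -> \bar R})
    (X : T -> R) (f : RB -> \bar R) :
  has_law nu X -> measurable_fun [set: RB] f -> (forall x, (0 <= f x)%E) ->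
  (\int[P]_w f (X w) = \int[nu]_x f x)%E.
Proof.
move=> [mX XE] mf f0.
have mX' : @measurable_fun _ _ T RB [set: T] X by exact: mX.
pose X' : {mfun T >-> RB} := @mfun_Sub _ _ T RB X (mem_set mX').
rewrite (_ : (\int[P]_w f (X w) = \int[distribution P X']_x f x)%E); last first.
  by rewrite ge0_integral_distribution.
apply: eq_measure_integral => A mA _.
by rewrite /= /distribution /pushforward /= XE.
Qed.

Definition independent_pair (X Y : T -> R) : Prop :=
  forall A B : set R, measurable A -> measurable B ->
    P (X @^-1` A `&` Y @^-1` B) = (P (X @^-1` A) * P (Y @^-1` B))%E.

(** Independence makes the product of the two laws agree with the joint law on
    rectangles, hence everywhere; Tonelli then splits the double integral. *)
Lemma ge0_integral_law_add (nu1 nu2 : probability RB R)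
    (X Y : T -> R) (f : RB -> \bar R) :
  has_law nu1 X -> has_law nu2 Y -> independent_pair X Y ->
  measurable_fun [set: RB] f -> (forall x, (0 <= f x)%E) ->
  (\int[P]_w f (X w + Y w)%R = \int[nu1]_x \int[nu2]_y f (x + y)%R)%E.
Proof.
move=> [mX XE] [mY YE] indXY mf f0.
have mXY : @measurable_fun _ _ T (RB * RB)%type [set: T] (fun w => (X w, Y w)).
  exact: (@measurable_fun_pair _ _ _ T RB RB).
pose Z : {mfun T >-> (RB * RB)%type} :=
  @mfun_Sub _ _ T (RB * RB)%type _ (mem_set mXY).
pose g (p : RB * RB) := f (p.1 + p.2)%R.
have mg : measurable_fun [set: RB * RB] g.
  apply: (measurableT_comp mf).
  by apply: (@measurable_funD _ _ R);
      [exact: measurable_fst|exact: measurable_snd].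
have g0 p : (0 <= g p)%E by exact: f0.
transitivity (\int[nu1 \x nu2]_p g p)%E; last first.
  by rewrite fubini_tonelli1.
transitivity (\int[distribution P Z]_p g p)%E.
  by rewrite ge0_integral_distribution.
apply/esym/eq_measure_integral => A mA _.
apply: product_measure_unique => // B C mB mC.
rewrite /distribution /pushforward /= -XE// -YE// -indXY//.
Qed.

End Laws.

(** * Centred normal laws on the line *)

Section NormalLaw.
Context (R : realType).
Local Notation mu := (@lebesgue_measure R).
Local Notation RB := (measurableTypeR R).
Implicit Types (s : R) (f : R -> \bar R).

(** The density is almost everywhere the Radon-Nikodym derivative. *)
Lemma ge0_integral_normal_prob m s f :
  measurable_fun [set: R] f -> (forall x, (0 <= f x)%E) ->
  (\int[normal_prob m s]_x f x = \int[mu]_x (f x * (normal_pdf m s x)%:E))%E.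
Proof.
move=> mf f0.
have dom := normal_prob_dominates m s.
rewrite -(Radon_Nikodym_SigmaFinite.change_of_variables dom)//.
have mp : measurable_fun [set: R] (EFin \o normal_pdf m s).
  by apply/measurable_EFinP; exact: measurable_normal_pdf.
have intf := Radon_Nikodym_SigmaFinite.f_integrable dom.
have mrn := measurable_int _ intf.
apply: ge0_ae_eq_integral => //.
- exact: emeasurable_funM.
- exact: emeasurable_funM.
- by move=> x _; rewrite mule_ge0// Radon_Nikodym_SigmaFinite.f_ge0.
- by move=> x _; rewrite mule_ge0// lee_fin normal_pdf_ge0.
- apply: ae_eqe_mul2l => /=.
  apply: integral_ae_eq => //=.
  by move=> E _ mE; rewrite -Radon_Nikodym_SigmaFinite.f_integral.
Qed.

Lemma lebesgue_measure_shift (a : R) (A : set R) : measurable A ->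
  pushforward mu (fun x => x + a : RB) A = mu A.
Proof.
move=> mA; apply/esym.
have ma : @measurable_fun _ _ RB RB [set: RB] (fun x => x + a).
  by apply: (@measurable_funD _ RB R).
pose phi : {mfun RB >-> RB} := @mfun_Sub _ _ RB RB _ (mem_set ma).
apply: (@lebesgue_measure_unique _ (pushforward mu phi)) => //= _ [[b c]] _ <-.
rewrite /pushforward/=.
have -> : phi @^-1` [set` Interval (BRight b) (BRight c)] =
   [set` Interval (BRight (b - a)) (BRight (c - a))].
  by apply/seteqP; split=> x /=; rewrite !in_itv/= ltrBlDr lerBrDr.
by rewrite !lebesgue_measure_itv/= !lte_fin ltrD2r; case: ifP => // _; 
  rewrite -!EFinB; congr _%:E; lra.
Qed.

Lemma ge0_integral_shift (a : R) f :
  measurable_fun [set: R] f -> (forall x, (0 <= f x)%E) ->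
  (\int[mu]_x f (x + a)%R = \int[mu]_x f x)%E.
Proof.
move=> mf f0.
have ma : @measurable_fun _ _ RB RB [set: RB] (fun x => x + a).
  by apply: (@measurable_funD _ RB R).
pose phi : {mfun RB >-> RB} := @mfun_Sub _ _ RB RB _ (mem_set ma).
transitivity (\int[pushforward mu phi]_x f x)%E.
  by rewrite ge0_integral_pushforward.
by apply: eq_measure_integral => A mA _; exact: lebesgue_measure_shift.
Qed.

Lemma ge0_integral_opp f :
  measurable_fun [set: R] f -> (forall x, (0 <= f x)%E) ->
  (\int[mu]_x f (- x)%R = \int[mu]_x f x)%E.
Proof.
move=> mf f0.
have ma : @measurable_fun _ _ RB RB [set: RB] (fun x => - x).
  exact: (@oppr_measurable R).
pose phi : {mfun RB >-> RB} := @mfun_Sub _ _ RB RB _ (mem_set ma).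
transitivity (\int[pushforward mu phi]_x f x)%E.
  by rewrite ge0_integral_pushforward.
by apply: eq_measure_integral => A mA _; exact: lebesgue_measureN.
Qed.

End NormalLaw.

Section CentredNormal.
Context (R : realType).
Local Notation mu := (@lebesgue_measure R).
Local Notation RB := (measurableTypeR R).
Implicit Types (s t : R) (f : R -> \bar R).

(** The scale 0 is given the Dirac mass, so that degenerate Gaussian variables
    belong to the same family; [normal_prob 0 0] would be a uniform law. *)
Definition normal0 (s : R) : probability RB R :=
  if s == 0 then \d_(0 : RB) : probability RB R else normal_prob 0 s.

Lemma ge0_integral_normal0 s f : s != 0 ->
  measurable_fun [set: R] f -> (forall x, (0 <= f x)%E) ->
  (\int[normal0 s]_x f x = \int[mu]_x (f x * (normal_pdf 0 s x)%:E))%E.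
Proof.
by move=> /negbTE s0 mf f0; rewrite /normal0 s0 ge0_integral_normal_prob.
Qed.

Lemma ge0_integral_normal00 f : measurable_fun [set: R] f ->
  (\int[normal0 0%R]_x f x = f 0%R)%E.
Proof.
move=> mf; rewrite /normal0 eqxx integral_dirac//=.
by rewrite diracT mul1e.
Qed.

Lemma normal0_opp s f :
  measurable_fun [set: R] f -> (forall x, (0 <= f x)%E) ->
  (\int[normal0 s]_x f (- x)%R = \int[normal0 s]_x f x)%E.
Proof.
move=> mf f0.
have mfN : measurable_fun [set: R] (fun x => f (- x)).
  exact: (measurableT_comp mf).
have [->|s0] := eqVneq s 0; first by rewrite !ge0_integral_normal00// oppr0.
rewrite !ge0_integral_normal0//.
rewrite -(@ge0_integral_opp R (fun x => f x * (normal_pdf 0 s x)%:E)%E).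
- apply: eq_integral => x _; congr (_ * _%:E)%E.
  by rewrite !normal_pdfE// /normal_fun !subr0 sqrrN.
- apply: emeasurable_funM => //.
  by apply/measurable_EFinP; exact: measurable_normal_pdf.
- by move=> x; rewrite mule_ge0// lee_fin normal_pdf_ge0.
Qed.

(** Completing the square in [x]: the product of the two densities is a normal
    density in [x], times a factor that depends on [y] only. *)
Lemma normal_pdf_conv s t x y : 0 < s -> 0 < t ->
  let r := Num.sqrt (s ^+ 2 + t ^+ 2) in
  normal_pdf 0 t (y - x) * normal_pdf 0 s x =
  normal_pdf 0 r y * normal_pdf (y * s ^+ 2 / r ^+ 2) (s * t / r) x.
Proof.
move=> s0 t0 r.
have r2 : r ^+ 2 = s ^+ 2 + t ^+ 2 by rewrite sqr_sqrtr// addr_ge0// sqr_ge0.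
have rgt0 : 0 < r by rewrite sqrtr_gt0 ltr_wpDr ?sqr_ge0 ?exprn_gt0.
clearbody r.
have rn0 : r != 0 by rewrite gt_eqF.
have st0 : 0 < s * t / r by rewrite divr_gt0// mulr_gt0.
have ste : (s * t / r) ^+ 2 = s ^+ 2 * t ^+ 2 / r ^+ 2 by field.
rewrite !normal_pdfE ?gt_eqF// mulrACA [RHS]mulrACA; congr (_ * _).
  have p0 (u : R) : 0 <= u ^+ 2 * pi *+ 2.
    by rewrite mulrn_wge0// mulr_ge0 ?sqr_ge0 ?pi_ge0.
  rewrite /normal_peak -!invfM -!sqrtrM//; congr (_^-1); congr Num.sqrt.
  rewrite ste; move: (pi : R) => p; rewrite -!(mulr_natr (_ * p)).
  by field.
rewrite /normal_fun -!expRD; congr expR.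
rewrite ste -!(mulr_natr (_ ^+ 2)) -!(mulr_natr (_ / _)) r2; field.
by rewrite -r2 !gt_eqF//= exprn_gt0.
Qed.

(** Translating the inner variable and exchanging the integrals leaves, by
    [normal_pdf_conv], the total mass of a normal density in [x]. *)
Lemma normal0_conv s t f : 0 <= s -> 0 <= t ->
  measurable_fun [set: R] f -> (forall x, (0 <= f x)%E) ->
  (\int[normal0 s]_x \int[normal0 t]_y f (x + y)%R =
   \int[normal0 (Num.sqrt (s ^+ 2 + t ^+ 2))]_x f x)%E.
Proof.
move=> s0 t0 mf f0.
have mfD x : measurable_fun [set: R] (fun y => f (x + y)).
  by apply: (measurableT_comp mf); exact: measurable_funD.
have mpdf u m : measurable_fun [set: R] (fun x : R => (normal_pdf m u x)%:E).
  by apply/measurable_EFinP; exact: measurable_normal_pdf.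
have mconv : measurable_fun [set: R]
    (fun x : R => \int[normal0 t]_y f (x + y)%R)%E.
  have mg : measurable_fun [set: RB * RB] (fun p : RB * RB => f (p.1 + p.2)%R).
    apply: (measurableT_comp mf).
    by apply: (@measurable_funD _ _ R);
      [exact: measurable_fst|exact: measurable_snd].
  exact: (@measurable_fun_fubini_tonelli_F _ _ RB RB R (normal0 t)
    (fun p => f (p.1 + p.2)%R)).
move: s0; rewrite le_eqVlt => /predU1P[<-|s0].
  have -> : Num.sqrt (0 ^+ 2 + t ^+ 2) = t.
    by rewrite expr0n/= add0r sqrtr_sqr ger0_norm.
  rewrite ge0_integral_normal00//.
  by apply: eq_integral => x _; rewrite add0r.
move: t0; rewrite le_eqVlt => /predU1P[t0|t0].
  have -> : Num.sqrt (s ^+ 2 + t ^+ 2) = s.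
    by rewrite -t0 expr0n/= addr0 sqrtr_sqr ger0_norm// ltW.
  rewrite -t0; apply: eq_integral => x _.
  by rewrite ge0_integral_normal00// addr0.
set r := Num.sqrt _.
have r0 : r != 0.
  by rewrite gt_eqF// sqrtr_gt0 ltr_wpDr ?sqr_ge0 ?exprn_gt0.
rewrite [RHS]ge0_integral_normal0//.
rewrite [LHS]ge0_integral_normal0 ?gt_eqF//; last first.
  by move=> x; exact: integral_ge0.
pose h (p : RB * RB) : \bar R :=
  (f p.2 * (normal_pdf 0 t (p.2 - p.1))%:E * (normal_pdf 0 s p.1)%:E)%E.
have h0 p : (0 <= h p)%E by rewrite /h !mule_ge0// lee_fin normal_pdf_ge0.
have mh : measurable_fun [set: RB * RB] h.
  apply: emeasurable_funM; first apply: emeasurable_funM.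
  - exact: (measurableT_comp mf (@measurable_snd _ _ RB RB)).
  - apply: (measurableT_comp (mpdf t 0)).
    by apply: (@measurable_funB _ _ R);
      [exact: measurable_snd|exact: measurable_fst].
  - exact: (measurableT_comp (mpdf s 0) (@measurable_fst _ _ RB RB)).
transitivity (\int[mu]_x \int[mu]_y h (x, y))%E.
  apply: eq_integral => x _; rewrite ge0_integral_normal0 ?gt_eqF//.
  transitivity (\int[mu]_y (f (x + y)%R * (normal_pdf 0 t y)%:E *
                            (normal_pdf 0 s x)%:E))%E.
    have m1 : measurable_fun [set: R]
        (fun y => f (x + y)%R * (normal_pdf 0 t y)%:E)%E.
      exact: emeasurable_funM.
    apply/esym/ge0_integralZr.
    - exact: measurableT.
    - exact: m1.
    - by move=> y _; rewrite mule_ge0// lee_fin normal_pdf_ge0.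
    - by rewrite lee_fin normal_pdf_ge0.
  have m2 : measurable_fun [set: R] (fun y : R => h (x, y)).
    exact: (measurableT_comp mh (@pair1_measurable _ _ RB RB x)).
  transitivity (\int[mu]_y h (x, (y + x)%R))%E; last exact: ge0_integral_shift.
  by apply: eq_integral => y _; rewrite /h/= addrK addrC.
transitivity (\int[mu]_y \int[mu]_x h (x, y))%E.
  exact: (@fubini_tonelli _ _ RB RB R mu mu h).
apply: eq_integral => y _; rewrite /h/=.
transitivity (\int[mu]_x (f y * (normal_pdf 0 r y)%:E *
    (normal_pdf (y * s ^+ 2 / r ^+ 2) (s * t / r) x)%:E))%E.
  apply: eq_integral => x _.
  by rewrite -muleA -EFinM normal_pdf_conv// EFinM muleA.
rewrite ge0_integralZl//.
- by rewrite integral_normal_pdf mule1.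
- exact: mpdf.
- by move=> x _; rewrite lee_fin normal_pdf_ge0.
- by rewrite mule_ge0// lee_fin normal_pdf_ge0.
Qed.

End CentredNormal.

Section NormalVariance.
Context (R : realType).
Local Notation mu := (@lebesgue_measure R).
Local Notation RB := (measurableTypeR R).

(** The second moment of a centred normal law is this constant times the square
    of the scale.  Being positive and finite, it makes the second moment
    determine the law. *)
Definition std_normal_moment2 : \bar R := (\int[normal0 1%R]_x (x ^+ 2)%:E)%E.

Lemma measurable_sqr : measurable_fun [set: R] (fun x : R => (x ^+ 2)%:E).
Proof. by apply/measurable_EFinP; exact: measurable_funX. Qed.

Lemma measurable_sqr_normal_pdf : measurable_fun [set: R]
  (fun x : R => (x ^+ 2)%:E * (normal_pdf 0 1 x)%:E)%E.
Proof.
apply: emeasurable_funM; first exact: measurable_sqr.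
by apply/measurable_EFinP; exact: measurable_normal_pdf.
Qed.

Lemma normal_pdf_scale (s x : R) : 0 < s ->
  normal_pdf 0 s (s * x) * s = normal_pdf 0 1 x.
Proof.
move=> s0; have sn0 : s != 0 by rewrite gt_eqF.
rewrite !normal_pdfE ?oner_neq0// /normal_fun !subr0 mulrAC; congr (_ * _).
  rewrite /normal_peak -mulrnAr sqrtrM ?sqr_ge0// sqrtr_sqr ger0_norm ?ltW//.
  by rewrite invfM mulrAC mulVf// expr1n -!mulrnAr mul1r mul1r.
by congr expR; rewrite -!(mulr_natr (_ ^+ 2)); field.
Qed.

(** Substitution of [s * x] for [x]. *)
Lemma normal0_sqr s : 0 <= s ->
  (\int[normal0 s]_x (x ^+ 2)%:E = (s ^+ 2)%:E * std_normal_moment2)%E.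
Proof.
have sq0 (x : R) : (0 <= (x ^+ 2)%:E)%E by rewrite lee_fin sqr_ge0.
rewrite le_eqVlt => /predU1P[<-|s0].
  rewrite ge0_integral_normal00; last exact: measurable_sqr.
  by rewrite expr0n/= mul0e.
have sn0 : s != 0 by rewrite gt_eqF.
rewrite /std_normal_moment2 !ge0_integral_normal0 ?oner_neq0//;
  try exact: measurable_sqr.
pose G (x : R) := x ^+ 2 * normal_pdf 0 s x.
have cG : continuous G.
  move=> x; apply: cvgM; first exact: exprn_continuous.
  exact: continuous_normal_pdf.
have F' : (fun x : R => s * x)^`()%classic = cst s.
  apply/funext => x; rewrite derive1E deriveZ//= derive_id [RHS]/=.
  exact: mulr1.
transitivity (\int[mu]_x (((G \o (fun x => s * x)) *
    ((fun x : R => s * x)^`()%classic)) x)%:E)%E.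
  rewrite -increasing_ge0_integration_by_substitutionT//.
  - by move=> x y xy; rewrite ltr_pM2l.
  - by rewrite F' => ?; exact: cvg_cst.
  - by rewrite F'; exact: is_cvg_cst.
  - by rewrite F'; exact: is_cvg_cst.
  - exact: gt0_cvgMrNy.
  - exact: gt0_cvgMry.
  - by move=> x; rewrite mulr_ge0 ?sqr_ge0 ?normal_pdf_ge0.
have mG1 := measurable_sqr_normal_pdf.
rewrite F' -ge0_integralZl//; first last.
- by move=> x _; rewrite mule_ge0// lee_fin normal_pdf_ge0.
have key (x : R) : (s * x) ^+ 2 * normal_pdf 0 s (s * x) * s =
    s ^+ 2 * (x ^+ 2 * normal_pdf 0 1 x).
  by rewrite -(normal_pdf_scale x s0); ring.
by apply: eq_integral => x _; rewrite /G -!EFinM; congr _%:E; exact: key.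
Qed.

(** On [1, 2] the integrand is at least the density at 2. *)
Lemma std_normal_moment2_gt0 : (0 < std_normal_moment2)%E.
Proof.
have mG1 := measurable_sqr_normal_pdf.
rewrite /std_normal_moment2 ge0_integral_normal0 ?oner_neq0//; first last.
- by move=> x; rewrite lee_fin sqr_ge0.
- exact: measurable_sqr.
pose c : R := normal_pdf 0 1 2.
have c0 : 0 < c.
  rewrite /c normal_pdfE ?oner_neq0//.
  by rewrite mulr_gt0 ?normal_peak_gt0 ?oner_neq0 ?expR_gt0.
have key (x : R) : 1 <= x -> x <= 2 -> c <= x ^+ 2 * normal_pdf 0 1 x.
  move=> x1 x2; have x21 : 1 <= x ^+ 2 by nra.
  rewrite -[leLHS]mul1r ler_pM ?ler01 ?(ltW c0)//.
  rewrite /c !normal_pdfE ?oner_neq0// ler_pM2l ?normal_peak_gt0 ?oner_neq0//.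
  rewrite ler_expR !subr0 !mulNr lerN2 ler_pM2r; last first.
    by rewrite invr_gt0 expr1n.
  by nra.
apply: (@lt_le_trans _ _ (\int[mu]_(x in `[1%R, 2%R]) (cst c%:E) x)%E).
  rewrite integral_cst//= lebesgue_measure_itv/= lte_fin ltr1n.
  rewrite -EFinB -EFinM lte_fin.
  by rewrite mulr_gt0// subr_gt0 ltr1n.
apply: (@le_trans _ _ (\int[mu]_(x in `[1%R, 2%R])
    ((x ^+ 2)%:E * (normal_pdf 0 1 x)%:E))%E).
  apply: ge0_le_integral => //=.
  - by move=> x _; rewrite lee_fin ltW.
  - exact: measurable_funS mG1.
  - move=> x /=; rewrite in_itv/= => /andP[x1 x2]; rewrite -EFinM lee_fin.
    exact: key.
apply: ge0_subset_integral => //=.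
by move=> x _; rewrite mule_ge0// lee_fin ?sqr_ge0 ?normal_pdf_ge0.
Qed.

(** As x^2 <= 4 exp (x^2 / 4), the integrand is at most a multiple of the normal
    density of variance 2. *)
Lemma std_normal_moment2_lty : (std_normal_moment2 < +oo)%E.
Proof.
have mG1 := measurable_sqr_normal_pdf.
rewrite /std_normal_moment2 ge0_integral_normal0 ?oner_neq0//; first last.
- by move=> x; rewrite lee_fin sqr_ge0.
- exact: measurable_sqr.
pose u : R := Num.sqrt 2.
have u2 : u ^+ 2 = 2 by rewrite sqr_sqrtr.
have u0 : u != 0 by rewrite gt_eqF// sqrtr_gt0.
pose k : R := 4 * normal_peak 1 / normal_peak u.
have k0 : 0 <= k by rewrite mulr_ge0 ?mulr_ge0 ?invr_ge0 ?normal_peak_ge0.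
have key (x : R) : x ^+ 2 * normal_pdf 0 1 x <= k * normal_pdf 0 u x.
  rewrite !normal_pdfE ?oner_neq0//.
  have p0 : normal_peak u != 0 by rewrite gt_eqF// normal_peak_gt0.
  have -> : k * (normal_peak u * normal_fun 0 u x) =
            normal_peak 1 * (4 * normal_fun 0 u x) by rewrite /k; field.
  rewrite [leLHS]mulrCA ler_wpM2l ?normal_peak_ge0//.
  rewrite /normal_fun u2 expr1n !subr0.
  have -> : - x ^+ 2 / 2 = - (x ^+ 2 / 4) + - x ^+ 2 / (2 *+ 2) :> R.
    by rewrite -(mulr_natr _ 2); field.
  rewrite expRD mulrA ler_wpM2r ?expR_ge0// expRN.
  rewrite ler_pdivrMr ?expR_gt0//.
  have := expR_ge1Dx (x ^+ 2 / 4); lra.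
apply: (@le_lt_trans _ _ (\int[mu]_x (k%:E * (normal_pdf 0 u x)%:E))%E).
  apply: ge0_le_integral => //=.
  - by move=> x _; rewrite mule_ge0// lee_fin ?sqr_ge0 ?normal_pdf_ge0.
  - apply: emeasurable_funM => //.
    by apply/measurable_EFinP; exact: measurable_normal_pdf.
  - by move=> x _; rewrite -!EFinM lee_fin; exact: key.
rewrite ge0_integralZl//; first last.
- by move=> x _; rewrite lee_fin normal_pdf_ge0.
- by apply/measurable_EFinP; exact: measurable_normal_pdf.
by rewrite integral_normal_pdf mule1 ltry.
Qed.

End NormalVariance.

(** * Expectations and square-integrable variables *)

Section MeasurableTrigo.
Context (R : realType).

Lemma measurable_sin : measurable_fun [set: R] (sin : R -> R).
Proof. by apply: continuous_measurable_fun; exact: continuous_sin. Qed.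

Lemma measurable_cos : measurable_fun [set: R] (cos : R -> R).
Proof. by apply: continuous_measurable_fun; exact: continuous_cos. Qed.

End MeasurableTrigo.

Section Expectation.
Context (d : measure_display) (T : measurableType d) (R : realType).
Variable P : probability T R.

Lemma Rintegral_prob_cst (a : R) : \int[P]_w a = a.
Proof.
by have := expectation_cst P a; rewrite unlock /Rintegral /cst => ->.
Qed.

Lemma bounded_integrable (f : T -> R) (M : R) : measurable_fun [set: T] f ->
  (forall w, `|f w| <= M) -> P.-integrable [set: T] (EFin \o f).
Proof.
move=> mf fM; apply: measurable_bounded_integrable => //.
  by apply: (@le_lt_trans _ _ 1%E); [exact: probability_le1|exact: ltry].
exists M; split; rewrite ?num_real// => x Mx w _ /=.
by rewrite (le_trans _ (ltW Mx)).
Qed.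

Lemma integrable_mul_bounded (e f : T -> R) (M : R) :
  P.-integrable [set: T] (EFin \o e) -> measurable_fun [set: T] f ->
  (forall w, `|f w| <= M) ->
  P.-integrable [set: T] (EFin \o (fun w => e w * f w)).
Proof.
move=> ie mf fM; have me : measurable_fun [set: T] e.
  by apply/measurable_EFinP; exact: measurable_int ie.
apply: (@le_integrable _ _ _ P setT measurableT _ (fun w => M%:E * (e w)%:E)%E).
- by apply/measurable_EFinP; exact: measurable_funM.
- move=> w _; rewrite -EFinM !abse_EFin lee_fin !normrM mulrC.
  by rewrite ler_wpM2r// (le_trans (fM w))// ler_norm.
- exact: integrableZl.
Qed.

Lemma Rintegral_cvg (f_ : nat -> T -> R) (f g : T -> R) :
  (forall n, measurable_fun [set: T] (f_ n)) ->
  (forall w, f_ n w @[n --> \oo] --> f w) ->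
  P.-integrable [set: T] (EFin \o g) ->
  (forall n w, `|f_ n w| <= g w) ->
  \int[P]_w f_ n w @[n --> \oo] --> \int[P]_w f w.
Proof.
move=> mf_ f_f ig f_g.
have mf : measurable_fun [set: T] f.
  exact: (measurable_fun_cvg mf_ (fun w _ => f_f w)).
have [||||| if_ _ cvgE] := @dominated_convergence _ T R P setT measurableT
  (fun n => EFin \o f_ n) (EFin \o f) (EFin \o g).
- by move=> n; exact/measurable_EFinP.
- exact/measurable_EFinP.
- by apply/aeW => w _; apply: cvg_EFin; [exact: nearW|exact: f_f].
- exact: ig.
- by apply/aeW => w n _ /=; rewrite lee_fin.
apply: fine_cvg.
rewrite /Rintegral fineK//; apply: integrable_fin_num => //.
Qed.

End Expectation.

Section SquareIntegrable.
Context (d : measure_display) (T : measurableType d) (R : realType).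
Variable P : probability T R.
Implicit Types X Y Z : T -> R.

Definition L2 (X : T -> R) : Prop :=
  measurable_fun [set: T] X /\
  P.-integrable [set: T] (EFin \o (fun w => X w ^+ 2)).

Lemma L2_measurable X : L2 X -> measurable_fun [set: T] X.
Proof. by case. Qed.

Lemma L2_integrableM X Y : L2 X -> L2 Y ->
  P.-integrable [set: T] (EFin \o (fun w => X w * Y w)).
Proof.
move=> [mX iX] [mY iY].
apply: (@le_integrable _ _ _ P setT measurableT _
  (fun w => (X w ^+ 2)%:E + (Y w ^+ 2)%:E)%E).
- by apply/measurable_EFinP; exact: measurable_funM.
- move=> w _; rewrite -EFinD !abse_EFin lee_fin normrM.
  have := sqr_ge0 (`|X w| - `|Y w|).
  rewrite [X in _ -> _ <= X]ger0_norm ?addr_ge0 ?sqr_ge0//.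
  rewrite -[X w ^+ 2]real_normK ?num_real// -[Y w ^+ 2]real_normK ?num_real//.
  have := normr_ge0 (X w); have := normr_ge0 (Y w); nra.
- exact: integrableD.
Qed.

Lemma L2_cst (a : R) : L2 (fun=> a).
Proof.
split; first exact: measurable_cst.
exact: finite_measure_integrable_cst.
Qed.

Lemma L2_integrable X : L2 X -> P.-integrable [set: T] (EFin \o X).
Proof.
move=> iX; have := L2_integrableM iX (L2_cst 1).
by apply: eq_integrable => // w _ /=; rewrite mulr1.
Qed.

Lemma L2_lin (a : R) X Y : L2 X -> L2 Y -> L2 (fun w => a * X w + Y w).
Proof.
move=> iX iY; have iXY := L2_integrableM iX iY.
case: (iX) (iY) => [mX sX] [mY sY]; split.
  by apply: measurable_funD => //; exact: measurable_funM.
apply: (@eq_integrable _ _ _ P setT measurableT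
  ((fun w => ((a ^+ 2)%:E * (X w ^+ 2)%:E) +
             (((2 * a)%:E * (X w * Y w)%:E) + (Y w ^+ 2)%:E))%E)).
  by move=> w _ /=; rewrite -!EFinM -!EFinD; congr _%:E; ring.
apply: integrableD => //; first exact: integrableZl.
by apply: integrableD => //; exact: integrableZl.
Qed.

Lemma L2_scale (a : R) X : L2 X -> L2 (fun w => a * X w).
Proof.
move=> iX; have := L2_lin a iX (L2_cst 0).
by congr L2; apply/funext => w; rewrite addr0.
Qed.

Definition inner X Y : R := \int[P]_w (X w * Y w).

Lemma innerC X Y : inner X Y = inner Y X.
Proof. by apply: eq_Rintegral => w _; rewrite mulrC. Qed.

Lemma innerDl (a : R) X Y Z : L2 X -> L2 Y -> L2 Z ->
  inner (fun w => a * X w + Y w) Z = a * inner X Z + inner Y Z.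
Proof.
move=> iX iY iZ; rewrite /inner -RintegralZl//; last exact: L2_integrableM.
rewrite -RintegralD//; last 2 first.
- have := L2_integrableM (L2_scale a iX) iZ.
  by apply: eq_integrable => // w _ /=; rewrite mulrA.
- exact: L2_integrableM.
by apply: eq_Rintegral => w _; rewrite mulrDl mulrA.
Qed.

End SquareIntegrable.

(** * Centred normal random variables *)

Section CentredNormalVariables.
Context (d : measure_display) (T : measurableType d) (R : realType).
Variable P : probability T R.
Local Notation mu := (@lebesgue_measure R).
Local Notation RB := (measurableTypeR R).
Implicit Types (X Y Z : T -> R) (s t : R).

Definition is_normal0 (s : R) (X : T -> R) : Prop :=
  0 <= s /\ has_law P (normal0 s) X.

Lemma is_normal0_sqr s X : is_normal0 s X ->
  (\int[P]_w (X w ^+ 2)%:E = (s ^+ 2)%:E * std_normal_moment2 R)%E.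
Proof.
move=> [s0 lX]; rewrite -normal0_sqr//.
rewrite -(ge0_integral_law (f := fun x : RB => (x ^+ 2)%:E) lX)//.
- exact: (@measurable_sqr R).
- by move=> x; rewrite lee_fin sqr_ge0.
Qed.

Lemma is_normal0_L2 s X : is_normal0 s X -> L2 P X.
Proof.
move=> nX; have [s0 [mX _]] := nX.
split=> //; apply/integrableP; split.
  by apply/measurable_EFinP; exact: measurable_funX.
under eq_integral do rewrite /= ger0_norm ?sqr_ge0//.
rewrite (is_normal0_sqr nX) lte_mul_pinfty ?lee_fin ?sqr_ge0//.
exact: std_normal_moment2_lty.
Qed.

Lemma is_normal0_inner s X : is_normal0 s X ->
  inner P X X = s ^+ 2 * fine (std_normal_moment2 R).
Proof.
move=> nX; rewrite /inner /Rintegral.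
under eq_integral do rewrite -expr2.
rewrite (is_normal0_sqr nX) fineM// ge0_fin_numE ?std_normal_moment2_lty//.
by rewrite ltW ?std_normal_moment2_gt0.
Qed.

Lemma fine_std_normal_moment2_gt0 : 0 < fine (std_normal_moment2 R).
Proof. by rewrite fine_gt0// std_normal_moment2_gt0 std_normal_moment2_lty. Qed.

(** The law is invariant under [x |-> - x], so the positive and the negative
    part have the same integral. *)
Lemma is_normal0_mean0 s X : is_normal0 s X -> \int[P]_w X w = 0.
Proof.
move=> nX; have iX := L2_integrable (is_normal0_L2 nX).
have [s0 lX] := nX.
rewrite /Rintegral integralE.
have -> : (\int[P]_w (EFin \o X)^\- w = \int[P]_w (EFin \o X)^\+ w)%E.
  pose g (x : R) : \bar R := (EFin^\+ x)%E.
  have mg : measurable_fun [set: R] g by exact: measurable_funepos.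
  have g0 x : (0 <= g x)%E by exact: funepos_ge0.
  have h := ge0_integral_law lX.
  transitivity (\int[normal0 s]_x g (- x)%R)%E.
    rewrite -(h (fun x : RB => g (- x)))//.
      by apply: eq_integral => w _; rewrite /g/= funeposE funenegE.
    exact: (measurableT_comp mg (@oppr_measurable R setT)).
  transitivity (\int[normal0 s]_x g x)%E; first exact: normal0_opp.
  rewrite -(h (g : RB -> \bar R))//.
  by apply: eq_integral => w _; rewrite /g/= !funeposE.
rewrite subee//; apply: integrable_pos_fin_num => //.
Qed.

(** Equal second moments force equal scales, hence equal laws. *)
Lemma is_normal0_cos_eq s s' X X' b : is_normal0 s X -> is_normal0 s' X' ->
  inner P X X = inner P X' X' ->
  \int[P]_w cos (X w + b) = \int[P]_w cos (X' w + b).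
Proof.
move=> nX nX'; rewrite (is_normal0_inner nX) (is_normal0_inner nX').
move/(mulIf (lt0r_neq0 fine_std_normal_moment2_gt0)) => ss'.
have {}ss' : s = s'.
  by apply/eqP; rewrite -(@eqrXn2 _ 2) ?ss' ?(nX.1) ?(nX'.1).
move: nX; rewrite {}ss' => nX.
have [s0 lX] := nX; have [_ lX'] := nX'.
(* The constant 1 makes the test function nonnegative. *)
pose g (x : R) : \bar R := (1 + cos (x + b))%:E.
have mcos := @measurable_cos R.
have mcosb : measurable_fun [set: R] (fun x : R => cos (x + b)).
  by apply: (measurableT_comp mcos); exact: measurable_funD.
have mg : measurable_fun [set: R] g.
  by apply/measurable_EFinP; exact: measurable_funD.
have g0 x : (0 <= g x)%E by rewrite lee_fin; have := cos_geN1 (x + b); lra.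
have : (\int[P]_w g (X w) = \int[P]_w g (X' w))%E.
  by rewrite (ge0_integral_law (f := g : RB -> \bar R) lX)//
    -(ge0_integral_law (f := g : RB -> \bar R) lX').
have icos Y : measurable_fun [set: T] Y ->
    P.-integrable [set: T] (EFin \o (fun w => cos (Y w + b))).
  move=> mY.
  apply: (bounded_integrable P (M := 1)) => [|w]; last exact: cos_max.
  exact: (measurableT_comp mcosb mY).
move/(congr1 fine).
have E Y : measurable_fun [set: T] Y ->
   fine (\int[P]_w g (Y w))%E = 1 + \int[P]_w cos (Y w + b).
  move=> mY; rewrite -[LHS]/(\int[P]_w (1 + cos (Y w + b))) RintegralD//.
  - by rewrite Rintegral_prob_cst.
  - exact: finite_measure_integrable_cst.
  - exact: icos.
by rewrite (E X lX.1) (E X' lX'.1) => /addrI.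
Qed.

Lemma is_normal0_add s t X Y :
  is_normal0 s X -> is_normal0 t Y -> independent_pair P X Y ->
  is_normal0 (Num.sqrt (s ^+ 2 + t ^+ 2)) (fun w => X w + Y w).
Proof.
move=> [s0 lX] [t0 lY] iXY; split; first exact: sqrtr_ge0.
have mXY : measurable_fun [set: T] (fun w => X w + Y w).
  by apply: measurable_funD; [exact: lX.1|exact: lY.1].
split=> // A mA.
have mi : measurable_fun [set: R] (fun x : R => (\1_A x)%:E : \bar R).
  by apply/measurable_EFinP; exact: measurable_indic.
have i0 x : (0 <= (\1_A x)%:E :> \bar R)%E by rewrite lee_fin.
have := ge0_integral_law_add (f := fun x : RB => (\1_A x)%:E) lX lY iXY mi i0.
move/(fun e => etrans e (normal0_conv s0 t0 mi i0)).
rewrite [X in _ = X -> _]integral_indic//= setIT => <-.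
have mXYA : measurable ((fun w => X w + Y w) @^-1` A).
  by have := mXY measurableT A mA; rewrite setTI.
by rewrite -[X in P X](setIT _) -integral_indic.
Qed.

(** Translation invariance of Lebesgue measure moves the mean to 0. *)
Lemma gaussian_normal0 X : gaussian P X ->
  exists m s, is_normal0 s (fun w => X w - m).
Proof.
move=> [mX law].
have mXB m : measurable_fun [set: T] (fun w => X w - m).
  exact: measurable_funB.
have mshift m A : measurable A -> measurable ((fun x : R => x - m) @^-1` A).
  move=> mA; rewrite -[X in measurable X]setTI.
  have mm : measurable_fun [set: R] (fun x : R => x - m).
    exact: measurable_funB.
  exact: mm.
case: law => [[m [s [s0 lX]]]|[m lX]]; exists m.
- exists s; split; first exact: ltW.
  split=> // A mA.
  have mi : measurable_fun [set: R] (fun x : R => (\1_A x)%:E : \bar R).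
    by apply/measurable_EFinP; exact: measurable_indic.
  pose B := (fun x : R => x - m) @^-1` A.
  have mB : measurable B by exact: mshift.
  have -> : (fun w => X w - m) @^-1` A = X @^-1` B by [].
  rewrite lX// /normal0 gt_eqF//.
  have ind (p : R -> R) C : measurable C ->
      (\int[mu]_(x in C) (p x)%:E = \int[mu]_x ((\1_C x)%:E * (p x)%:E))%E.
    move=> mC; rewrite integral_mkcond; apply: eq_integral => x _.
    by rewrite patchE indicE; case: ifP; rewrite ?mul1e ?mul0e.
  pose h (x : R) : \bar R := ((\1_A x)%:E * (normal_pdf 0 s x)%:E)%E.
  apply: (etrans (ind (normal_pdf m s) B mB)).
  apply: (etrans _ (esym (ind (normal_pdf 0 s) A mA))).
  transitivity (\int[mu]_x h (x + - m)%R)%E.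
    apply: eq_integral => x _; rewrite /h; congr (_ * _%:E)%E.
    by rewrite !normal_pdfE ?gt_eqF// /normal_fun subr0.
  apply: ge0_integral_shift.
    apply: emeasurable_funM => //.
    by apply/measurable_EFinP; exact: measurable_normal_pdf.
  by move=> x; rewrite mule_ge0// lee_fin normal_pdf_ge0.
- exists 0; split => //.
  split=> // A mA.
  rewrite /normal0 eqxx.
  pose B := (fun x : R => x - m) @^-1` A.
  have mB : measurable B by exact: mshift.
  have -> : (fun w => X w - m) @^-1` A = X @^-1` B by [].
  rewrite lX//= !diracE.
  suff -> : (m \in B) = ((0 : R) \in A) by [].
  by apply/idP/idP; rewrite !inE /B /= subrr.
Qed.

(** The centring constant of [gaussian_normal0] is the mean. *)
Lemma gaussian_mean0_normal0 X : gaussian P X -> \int[P]_w X w = 0 ->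
  exists s, is_normal0 s X.
Proof.
move=> gX X0; have [m [s nX]] := gaussian_normal0 gX.
suff m0 : m = 0.
  exists s; move: nX; rewrite m0; congr is_normal0.
  by apply/funext => w; rewrite subr0.
have iX := L2_integrable (is_normal0_L2 nX).
have : \int[P]_w ((X w - m) + m) = m.
  rewrite RintegralD// ?(is_normal0_mean0 nX) ?add0r.
    exact: Rintegral_prob_cst.
  exact: finite_measure_integrable_cst.
have -> : \int[P]_w (X w - m + m) = \int[P]_w X w.
  by apply: eq_Rintegral => w _; rewrite subrK.
by rewrite X0.
Qed.

End CentredNormalVariables.

(** * Gaussian spaces *)

Section LinearlyClosed.
Context (T : Type) (R : realType).

Definition lin_closed (S : set (T -> R)) : Prop :=
  S (fun=> 0) /\ (forall a f g, S f -> S g -> S (fun w => a * f w + g w)).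

Lemma lin_closed_sum S (I : Type) (s : seq I) (a : I -> R) (X : I -> T -> R) :
  lin_closed S -> (forall i, S (X i)) ->
  S (fun w => \sum_(i <- s) a i * X i w).
Proof.
move=> [S0 Sl] SX; elim: s => [|x s IH].
  have -> : (fun w => \sum_(i <- [::]) a i * X i w) = fun=> 0.
    by apply/funext => w; rewrite big_nil.
  exact: S0.
have -> : (fun w => \sum_(i <- x :: s) a i * X i w) =
    (fun w => a x * X x w + \sum_(i <- s) a i * X i w).
  by apply/funext => w; rewrite big_cons.
exact: Sl.
Qed.

End LinearlyClosed.

Section SinAtZero.
Context (R : realType).
Implicit Types x : R.

Lemma norm_sin_le x : `|sin x| <= `|x|.
Proof.
wlog x0 : x / 0 <= x => [h|].
  have [|/ltW x0] := leP 0 x; first exact: h.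
  by rewrite -[sin x]opprK -sinN normrN -(normrN x); apply: h; rewrite oppr_ge0.
have [c _] := MVT_segment x0 (fun y _ => is_derive_sin y)
  (continuous_subspaceT (@continuous_sin R)).
rewrite sin0 !subr0 => ->; rewrite normrM ler_piMl//.
exact: cos_max.
Qed.

Lemma norm_1Bcos_le x : `|cos x - 1| <= `|x|.
Proof.
wlog x0 : x / 0 <= x => [h|].
  have [|/ltW x0] := leP 0 x; first exact: h.
  by rewrite -cosN -(normrN x); apply: h; rewrite oppr_ge0.
have [c _] := MVT_segment x0 (fun y _ => is_derive_cos y)
  (continuous_subspaceT (@continuous_cos R)).
rewrite cos0 !subr0 => ->; rewrite normrM ler_piMl// normrN.
exact: sin_max.
Qed.

Lemma norm_sinB_le x : `|sin x - x| <= x ^+ 2.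
Proof.
wlog x0 : x / 0 <= x => [h|].
  have [|/ltW x0] := leP 0 x; first exact: h.
  by rewrite -normrN opprD -sinN -(sqrrN x); apply: h; rewrite oppr_ge0.
have [c + ] := MVT_segment x0 (fun y _ => is_derive_sin y)
  (continuous_subspaceT (@continuous_sin R)).
rewrite in_itv/= => /andP[c0 cx].
rewrite sin0 !subr0 => ->.
rewrite -{2}[x]mul1r -mulrBl normrM expr2 (ger0_norm x0) ler_wpM2r//.
by rewrite (le_trans (norm_1Bcos_le c))// ger0_norm.
Qed.

(** The derivative of the sine at 0, in the form in which it is used under an
    expectation. *)
Lemma cvg_sin_scale x : n.+1%:R * sin (n.+1%:R^-1 * x) @[n --> \oo] --> x.
Proof.
apply/cvgrPdist_le => e e0.
have h := @cvg_harmonic R.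
have : x ^+ 2 * harmonic n @[n --> \oo] --> (0 : R).
  by rewrite -(mulr0 (x ^+ 2)); apply: cvgM => //; exact: cvg_cst.
move/cvgrPdist_le => /(_ e e0); apply: filterS => n.
rewrite sub0r normrN /harmonic.
rewrite /= [X in X <= _]ger0_norm ?divr_ge0 ?sqr_ge0// => he.
rewrite (le_trans _ he)//.
have : (0 : R) < n.+1%:R by [].
move: (n.+1%:R : R) => N N0.
have Nn0 : N != 0 by rewrite gt_eqF.
have -> : x - N * sin (N^-1 * x) = - N * (sin (N^-1 * x) - N^-1 * x) by field.
rewrite mulNr normrN normrM (ger0_norm (ltW N0)).
rewrite (le_trans (ler_wpM2l (ltW N0) (norm_sinB_le _)))//.
by rewrite le_eqVlt; apply/orP; left; apply/eqP; field.
Qed.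

End SinAtZero.

Section GaussianSpace.
Context (d : measure_display) (T : measurableType d) (R : realType).
Variable P : probability T R.
Variable H : set (T -> R).

Definition gaussian_space : Prop :=
  lin_closed H /\ forall X, H X -> exists s, is_normal0 P s X.

Hypothesis gH : gaussian_space.

Lemma gaussian_space_L2 X : H X -> L2 P X.
Proof. by move=> /gH.2[s]; exact: is_normal0_L2. Qed.

(** Orthogonality in a Gaussian space acts like independence.  The variables
    a X + W and - a X + W have the same second moment, hence the same law;
    subtracting the expectations of cos (a X + W + b) and cos (- a X + W + b)
    gives E[sin (a X) sin (W + b)] = 0.  Dividing by [a = 1 / (n + 1)] and
    letting [n] grow replaces sin (a X) by X, with |X| as dominating
    function. *)
Lemma orth_sin X W b : H X -> H W -> inner P X W = 0 ->
  \int[P]_w (X w * sin (W w + b)) = 0.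
Proof.
move=> HX HW XW0.
have L2X := gaussian_space_L2 HX; have L2W := gaussian_space_L2 HW.
have mX := L2_measurable L2X; have mW := L2_measurable L2W.
have msin := @measurable_sin R.
have mcos := @measurable_cos R.
have msinW : measurable_fun [set: T] (fun w => sin (W w + b)).
  by apply: (measurableT_comp msin); exact: measurable_funD.
have msinX a : measurable_fun [set: T] (fun w => sin (a * X w)).
  by apply: (measurableT_comp msin); exact: measurable_funM.
have sin0 a : \int[P]_w (sin (a * X w) * sin (W w + b)) = 0.
  have [s n1] := gH.2 _ (gH.1.2 a _ _ HX HW).
  have [s' n2] := gH.2 _ (gH.1.2 (- a) _ _ HX HW).
  have vv c : inner P (fun w => c * X w + W w) (fun w => c * X w + W w) =
      c ^+ 2 * inner P X X + inner P W W.
    have L2c := L2_lin c L2X L2W.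
    rewrite innerDl// (innerC P X) (innerC P W) !innerDl//.
    by rewrite (innerC P W X) XW0; ring.
  have := is_normal0_cos_eq b n1 n2.
  rewrite !vv sqrrN => /(_ erefl) ecos.
  have icos c : P.-integrable [set: T]
      (EFin \o (fun w => cos (c * X w + W w + b))).
    apply: (bounded_integrable P (M := 1)) => [|w]; last exact: cos_max.
    apply: (measurableT_comp mcos); apply: measurable_funD => //.
    by apply: measurable_funD => //; exact: measurable_funM.
  have -> : \int[P]_w (sin (a * X w) * sin (W w + b)) =
      \int[P]_w (2^-1 * (cos (- a * X w + W w + b) - cos (a * X w + W w + b))).
    apply: eq_Rintegral => w _.
    by rewrite -!addrA mulNr !cosD cosN sinN; field.
  rewrite RintegralZl//; last first.
    have := integrableB measurableT (icos (- a)) (icos a).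
    by apply: eq_integrable.
  by rewrite RintegralB// ecos subrr mulr0.
have cv : \int[P]_w ((n.+1%:R * sin (n.+1%:R^-1 * X w)) * sin (W w + b))
     @[n --> \oo] --> \int[P]_w (X w * sin (W w + b)).
  apply: (Rintegral_cvg (g := fun w => `|X w|)).
  - by move=> n; apply: measurable_funM => //; exact: measurable_funM.
  - by move=> w; apply: cvgM; [exact: cvg_sin_scale|exact: cvg_cst].
  - exact: integrable_norm (L2_integrable L2X).
  - move=> n w; rewrite !normrM (le_trans (ler_piMr _ (sin_max _)))//.
    rewrite (ger0_norm (ler0n _ _)).
    rewrite (le_trans (ler_wpM2l (ler0n _ _) (norm_sin_le _)))//.
    by rewrite normrM ger0_norm ?invr_ge0// mulrA divff ?mul1r// pnatr_eq0.
have cv0 : \int[P]_w ((n.+1%:R * sin (n.+1%:R^-1 * X w)) * sin (W w + b))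
     @[n --> \oo] --> (0 : R).
  rewrite (_ : (fun n => _) = fun=> 0); first exact: cvg_cst.
  apply/funext => n.
  under eq_Rintegral do rewrite -mulrA.
  rewrite RintegralZl// ?sin0 ?mulr0//.
  apply: (bounded_integrable P (M := 1)); first exact: measurable_funM.
  by move=> w; rewrite normrM mulr_ile1 ?normr_ge0 ?sin_max.
by apply: (cvg_unique _ cv cv0).
Qed.

End GaussianSpace.

(** * Events generated by sines *)

Section SigmaFamily.
Context (d : measure_display) (T : measurableType d) (R : realType).
Variables (I : Type) (Y : I -> T -> R).

Lemma sigma_family_gen i (B : set R) :
  measurable B -> sigma_family Y (Y i @^-1` B).
Proof.
move=> mB; apply: sub_sigma_algebra; exists i => //.
by exists B => //; rewrite setTI.
Qed.

Lemma sigma_family_measurable A :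
  (forall i, measurable_fun [set: T] (Y i)) -> sigma_family Y A -> measurable A.
Proof.
move=> mY; apply: smallest_sub.
  split; [exact: measurable0| |exact: bigcupT_measurable].
  by move=> B mB; rewrite setTD; exact: measurableC.
by move=> _ [i _ [B mB <-]]; exact: mY.
Qed.

End SigmaFamily.

Section BoundedClosure.
Context (T : Type) (R : realType).
Variable V : set (T -> R).
Hypothesis Vlin : lin_closed V.

(** Stability under products is a theorem, not a constructor: a functional that
    vanishes on the sines and respects bounded limits must be seen to vanish on
    the whole class, by induction on its generation. *)
Inductive trig_closure : (T -> R) -> Prop :=
| trig_closure_sin X b : V X -> trig_closure (fun w => sin (X w + b))
| trig_closure_lin a f g : trig_closure f -> trig_closure g ->
    trig_closure (fun w => a * f w + g w)
| trig_closure_lim (f_ : nat -> T -> R) f M : (forall n, trig_closure (f_ n)) ->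
    (forall n w, `|f_ n w| <= M) ->
    (forall w, f_ n w @[n --> \oo] --> f w) -> trig_closure f.

Lemma cvg_norm_le (u : nat -> R) (l M : R) :
  (forall n, `|u n| <= M) -> u n @[n --> \oo] --> l -> `|l| <= M.
Proof.
move=> uM ul.
by apply: (cvgr_to_le (cvg_norm ul)); exact: nearW.
Qed.

Lemma trig_closure_bounded f : trig_closure f ->
  exists M : R, forall w, `|f w| <= M.
Proof.
elim=> [X b _|a g h _ [M gM] _ [N hN]|f_ g M _ _ fM fg].
- by exists 1 => w; exact: sin_max.
- exists (`|a| * M + N) => w; rewrite (le_trans (ler_normD _ _))//.
  by rewrite lerD// normrM ler_wpM2l.
- by exists M => w; apply: cvg_norm_le (fg w) => n.
Qed.

Lemma trig_closure_cst a : trig_closure (fun=> a).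
Proof.
have -> : (fun=> a) =
    (fun w : T => (a - 1) * sin (0 + pi / 2) + sin (0 + pi / 2)).
  by apply/funext => w; rewrite add0r sin_pihalf; ring.
by apply: trig_closure_lin; apply: trig_closure_sin; exact: Vlin.1.
Qed.

Lemma trig_closure_scale a f : trig_closure f ->
  trig_closure (fun w => a * f w).
Proof.
move=> cf; have -> : (fun w => a * f w) = (fun w => a * f w + 0).
  by apply/funext => w; rewrite addr0.
by apply: trig_closure_lin => //; exact: trig_closure_cst.
Qed.

Lemma trig_closure_add f g : trig_closure f -> trig_closure g ->
  trig_closure (fun w => f w + g w).
Proof.
move=> cf cg; have -> : (fun w => f w + g w) = (fun w => 1 * f w + g w).
  by apply/funext => w; rewrite mul1r.
exact: trig_closure_lin.
Qed.

Lemma trig_closure_sub f g : trig_closure f -> trig_closure g ->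
  trig_closure (fun w => f w - g w).
Proof.
move=> cf cg; have -> : (fun w => f w - g w) = (fun w => -1 * g w + f w).
  by apply/funext => w; ring.
exact: trig_closure_lin.
Qed.

(** A product of two sines is half a difference of two sines with shifted
    phases, whose arguments stay in the linear space [V]. *)
Lemma trig_closure_mul_sin X b f : V X -> trig_closure f ->
  trig_closure (fun w => sin (X w + b) * f w).
Proof.
move=> VX; elim=> [Y c VY|a g h _ cg _ ch|f_ g M _ cf_ fM fg].
- have -> : (fun w => sin (X w + b) * sin (Y w + c)) =
    (fun w => 2^-1 * (sin ((-1 * Y w + X w) + (b - c + pi / 2)) -
                      sin ((1 * Y w + X w) + (b + c + pi / 2)))).
    apply/funext => w.
    rewrite (_ : -1 * Y w + X w + (b - c + pi / 2) =
       ((X w + b) - (Y w + c)) + pi / 2); last by ring.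
    rewrite (_ : 1 * Y w + X w + (b + c + pi / 2) =
       ((X w + b) + (Y w + c)) + pi / 2); last by ring.
    by rewrite !sinDpihalf (cosB (X w + b)) (cosD (X w + b)); field.
  apply/trig_closure_scale/trig_closure_sub;
    by apply: trig_closure_sin; exact: Vlin.2.
- have -> : (fun w => sin (X w + b) * (a * g w + h w)) =
    (fun w => a * (sin (X w + b) * g w) + sin (X w + b) * h w).
    by apply/funext => w; ring.
  exact: trig_closure_lin.
- apply: (trig_closure_lim
    (f_ := fun n w => sin (X w + b) * f_ n w) (M := M)) => //.
  + move=> n w; rewrite normrM -[leRHS]mul1r ler_pM//; exact: sin_max.
  + by move=> w; apply: cvgM => //; exact: cvg_cst.
Qed.

Lemma trig_closure_mul f g : trig_closure f -> trig_closure g ->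
  trig_closure (fun w => f w * g w).
Proof.
move=> + cg; elim=> [X b VX|a h k _ ch _ ck|f_ h M _ cf_ fM fh].
- exact: trig_closure_mul_sin.
- have -> : (fun w => (a * h w + k w) * g w) =
    (fun w => a * (h w * g w) + k w * g w) by apply/funext => w; ring.
  exact: trig_closure_lin.
- have [N gN] := trig_closure_bounded cg.
  apply: (trig_closure_lim (f_ := fun n w => f_ n w * g w) (M := M * N)) => //.
  + by move=> n w; rewrite normrM ler_pM.
  + by move=> w; apply: cvgM => //; exact: cvg_cst.
Qed.

Lemma trig_closure_exp n f : trig_closure f -> trig_closure (fun w => f w ^+ n).
Proof.
move=> cf; elim: n => [|n IH]; first exact: trig_closure_cst.
have -> : (fun w => f w ^+ n.+1) = (fun w => f w * f w ^+ n).
  by apply/funext => w; rewrite exprS.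
exact: trig_closure_mul.
Qed.

(** Iteration that increases to the square root of [x ^+ 2]; every step is a
    polynomial in [x], so it can be carried out inside the closure. *)
Fixpoint abs_approx (n : nat) (x : R) : R :=
  if n is m.+1 then abs_approx m x + (x ^+ 2 - abs_approx m x ^+ 2) / 2 else 0.

(** One step multiplies the error by 1 - (|x| + q) / 2, where [q >= 0] is the
    current approximation. *)
Lemma abs_approx_bound n x : `|x| <= 1 ->
  0 <= abs_approx n x <= `|x| /\
  `|x| - abs_approx n x <= `|x| * (1 - `|x| / 2) ^+ n.
Proof.
move=> x1; have x0 := normr_ge0 x.
elim: n => [|n [/andP[q0 qx] IH]] /=.
  by rewrite lexx x0 subr0 expr0 mulr1.
set q := abs_approx n x in q0 qx IH *.
have x2 : x ^+ 2 = `|x| ^+ 2 by rewrite real_normK ?num_real.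
have E : `|x| - (q + (x ^+ 2 - q ^+ 2) / 2) = (`|x| - q) * (1 - (`|x| + q) / 2).
  by rewrite x2; field.
have d0 : 0 <= `|x| - q by rewrite subr_ge0.
have f0 : 0 <= 1 - (`|x| + q) / 2 by lra.
have f1 : 1 - (`|x| + q) / 2 <= 1 - `|x| / 2 by lra.
split.
  apply/andP; split.
    by rewrite addr_ge0// divr_ge0// x2 subr_ge0 lerXn2r.
  by rewrite -subr_ge0 E mulr_ge0.
by rewrite E exprSr mulrA ler_pM.
Qed.

Lemma cvg_abs_approx x : `|x| <= 1 -> abs_approx n x @[n --> \oo] --> `|x|.
Proof.
move=> x1; have [->|xn0] := eqVneq x 0.
  have z n : abs_approx n 0 = 0.
    have z1 : `|0 : R| <= 1 by rewrite normr0.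
    have [+ _] := abs_approx_bound n z1.
    by rewrite normr0 => /andP[q0 q1]; apply/eqP; rewrite eq_le q0 q1.
  by rewrite normr0 (_ : (fun n => _) = fun=> 0); [exact: cvg_cst|exact/funext].
have x0 : 0 < `|x| by rewrite normr_gt0.
have g : `|x| * (1 - `|x| / 2) ^+ n @[n --> \oo] --> (0 : R).
  rewrite -(mulr0 `|x|); apply: cvgM; first exact: cvg_cst.
  apply: cvg_expr; rewrite ger0_norm; lra.
have h : `|x| - `|x| * (1 - `|x| / 2) ^+ n @[n --> \oo] --> `|x|.
  by rewrite -[X in _ --> X]subr0; apply: cvgB => //; exact: cvg_cst.
apply: (squeeze_cvgr _ h (cvg_cst _)).
apply: nearW => n; have [/andP[_ ->] B] := abs_approx_bound n x1.
by rewrite andbT; lra.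
Qed.

Lemma trig_closure_norm f : trig_closure f -> (forall w, `|f w| <= 1) ->
  trig_closure (fun w => `|f w|).
Proof.
move=> cf f1.
apply: (trig_closure_lim (f_ := fun n w => abs_approx n (f w)) (M := 1)).
- elim=> [|n IH] /=; first exact: trig_closure_cst.
  apply: trig_closure_add => //.
  have -> : (fun w => (f w ^+ 2 - abs_approx n (f w) ^+ 2) / 2) =
     (fun w => 2^-1 * (f w ^+ 2 - abs_approx n (f w) ^+ 2)).
    by apply/funext => w; rewrite mulrC.
  by apply/trig_closure_scale/trig_closure_sub; exact: trig_closure_exp.
- move=> n w; have [/andP[q0 q1] _] := abs_approx_bound n (f1 w).
  by rewrite ger0_norm// (le_trans q1).
- by move=> w; exact: cvg_abs_approx.
Qed.

Definition trig_closure_set (A : set T) : Prop := trig_closure (\1_A).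

(** Let [g] be [f] scaled so that |g| <= 1.  Then [h = (|g| + g) / 2] takes
    values in [0, 1] and is positive exactly where [f] is, and
    1 - (1 - h)^n tends to the indicator of that set. *)
Lemma trig_closure_set_pos f : trig_closure f ->
  trig_closure_set [set w | 0 < f w].
Proof.
move=> cf; have [M fM] := trig_closure_bounded cf.
pose N : R := `|M| + 1; have N0 : 0 < N by rewrite ltr_wpDl.
pose g w : R := N^-1 * f w.
have cg : trig_closure g by exact: trig_closure_scale.
have g1 w : `|g w| <= 1.
  rewrite normrM ger0_norm ?invr_ge0 ?(ltW N0)// mulrC ler_pdivrMr// mul1r.
  by rewrite (le_trans (fM w))// (le_trans (ler_norm M))// lerDl.
pose h w : R := 2^-1 * (`|g w| + g w).
have ch : trig_closure h.
  by apply/trig_closure_scale/trig_closure_add => //; exact: trig_closure_norm.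
have h01 w : 0 <= h w <= 1.
  rewrite /h; have := g1 w; have := ler_norm (g w); have := ler_norm (- g w).
  by rewrite normrN => ? ? ?; apply/andP; split; lra.
apply: (trig_closure_lim (f_ := fun n w => 1 - (1 - h w) ^+ n) (M := 1)).
- move=> n; apply: trig_closure_sub; first exact: trig_closure_cst.
  apply: trig_closure_exp; apply: trig_closure_sub => //.
  exact: trig_closure_cst.
- move=> n w; have /andP[h0 h1] := h01 w.
  have e0 : 0 <= (1 - h w) ^+ n by rewrite exprn_ge0// subr_ge0.
  have e1 : (1 - h w) ^+ n <= 1 by rewrite exprn_ile1 ?subr_ge0// gerBl.
  by rewrite ger0_norm; lra.
- move=> w; rewrite indicE; have [f0|f0] := ltP 0 (f w).
    rewrite mem_set//= -[X in _ --> X]subr0.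
    apply: cvgB; first exact: cvg_cst.
    have h0 : 0 < h w.
      have : 0 < g w by rewrite mulr_gt0// invr_gt0.
      by rewrite /h => g0; rewrite gtr0_norm//; lra.
    by apply: cvg_expr; have /andP[? ?] := h01 w; rewrite ger0_norm; lra.
  rewrite memNset/=; last by rewrite /= ltNge f0.
  have -> : h w = 0.
    rewrite /h ler0_norm ?addNr ?mulr0//.
    by rewrite mulr_ge0_le0// invr_ge0 ltW.
  rewrite (_ : (fun n => _) = fun=> 0); first exact: cvg_cst.
  by apply/funext => n; rewrite subr0 expr1n subrr.
Qed.

Lemma trig_closure_setC A : trig_closure_set A -> trig_closure_set (~` A).
Proof.
move=> cA; rewrite /trig_closure_set.
have -> : (\1_(~` A) : T -> R) = (fun w => 1 - \1_A w).
  apply/funext => w; rewrite !indicE in_setC.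
  by case: (w \in A); rewrite ?subrr ?subr0.
by apply: trig_closure_sub => //; exact: trig_closure_cst.
Qed.

Lemma trig_closure_setI A B : trig_closure_set A -> trig_closure_set B ->
  trig_closure_set (A `&` B).
Proof.
move=> cA cB; rewrite /trig_closure_set.
have -> : (\1_(A `&` B) : T -> R) = (fun w => \1_A w * \1_B w).
  by apply/funext => w; rewrite indicI.
exact: trig_closure_mul.
Qed.

Lemma trig_closure_set_sigma : sigma_algebra [set: T] trig_closure_set.
Proof.
split.
- by rewrite /trig_closure_set indic0; exact: trig_closure_cst.
- by move=> A cA; rewrite setTD; exact: trig_closure_setC.
- move=> A cA.
  have cU n : trig_closure_set (\big[setU/set0]_(k < n) A k).
    elim: n => [|n IH].
      by rewrite big_ord0 /trig_closure_set indic0; exact: trig_closure_cst.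
    rewrite big_ord_recr/= -[X in trig_closure_set X]setCK setCU.
    by apply/trig_closure_setC/trig_closure_setI; exact: trig_closure_setC.
  apply: (trig_closure_lim
    (f_ := fun n => \1_(\big[setU/set0]_(k < n) A k)) (M := 1)) => //.
  + by move=> n w; rewrite indicE; case: (_ \in _); rewrite ?normr1 ?normr0.
  + move=> w; rewrite indicE; apply: cvg_near_cst.
    have [[k _ Akw]|nA] := pselect ((\bigcup_k A k) w).
      exists k.+1 => // n /= kn; rewrite indicE !mem_set//; first by exists k.
      rewrite -bigcup_mkord; exists k => //=.
    apply: nearW => n; rewrite indicE !memNset// -bigcup_mkord => -[k _ Akw].
    by apply: nA; exists k.
Qed.

(** For each point, sin ((X - c) / (n + 1)) has the sign of X - c as soon as
    |X - c| / (n + 1) is less than pi. *)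
Lemma trig_closure_set_ray X c : V X -> trig_closure_set [set w | c < X w].
Proof.
move=> VX.
have Vs a : V (fun w => a * X w).
  have := Vlin.2 a _ _ VX Vlin.1.
  rewrite (_ : (fun w => _ + 0) = fun w => a * X w)//.
  by apply/funext => w; rewrite addr0.
apply: (trig_closure_lim (f_ := fun n =>
   \1_[set w | 0 < sin (n.+1%:R^-1 * X w + - (n.+1%:R^-1 * c))]) (M := 1)).
- by move=> n; apply/trig_closure_set_pos/trig_closure_sin.
- by move=> n w; rewrite indicE; case: (_ \in _); rewrite ?normr1 ?normr0.
move=> w; apply: cvg_near_cst.
have : \forall n \near \oo, n.+1%:R^-1 * `|X w - c| < pi.
  have : n.+1%:R^-1 * `|X w - c| @[n --> \oo] --> (0 : R).
    rewrite -(mul0r `|X w - c|); apply: cvgM; last exact: cvg_cst.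
    exact: cvg_harmonic.
  by move/cvgr_lt; apply; exact: pi_gt0.
apply: filterS => n npi; rewrite !indicE.
have i0 : (0 : R) < n.+1%:R^-1 by rewrite invr_gt0.
have [cX|cX] := ltP c (X w).
  rewrite !mem_set//= -mulrBr; apply: sin_gt0_pi.
  rewrite -{2}(@gtr0_norm _ (X w - c)) ?subr_gt0// npi andbT.
  by rewrite mulr_gt0// subr_gt0.
rewrite !memNset//=; first by rewrite ltNge cX.
apply/negP; rewrite -leNgt -mulrBr -[_ * _]opprK sinN oppr_le0 -mulrN opprB.
apply: sin_ge0_pi; rewrite mulr_ge0 ?(ltW i0) ?subr_ge0//=.
by move: npi; rewrite ler0_norm ?subr_le0// opprB => /ltW.
Qed.

Lemma trig_closure_set_preimage X B : V X -> measurable B ->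
  trig_closure_set (X @^-1` B).
Proof.
move=> VX mB.
have {}mB : (@RGenOInfty.G R).-sigma.-measurable B.
  by rewrite -RGenOInfty.measurableE.
have [s0 sC sU] := trig_closure_set_sigma.
have sig : sigma_algebra [set: R] [set B | trig_closure_set (X @^-1` B)].
  split => /=.
  - by rewrite preimage_set0.
  - by move=> A cA; rewrite setTD preimage_setC -setTD; exact: sC.
  - by move=> A cA; rewrite preimage_bigcup; exact: sU.
apply: (smallest_sub sig _ mB) => _ [x ->] /=.
rewrite (_ : _ @^-1` _ = [set w | x < X w]); first exact: trig_closure_set_ray.
by apply/seteqP; split => w /=; rewrite in_itv/= andbT.
Qed.

End BoundedClosure.

Section OrthogonalIndependent.
Context (d : measure_display) (T : measurableType d) (R : realType).
Variable P : probability T R.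

Lemma sigma_family_trig_closure_set (V : set (T -> R)) (I : Type)
    (Y : I -> T -> R) (A : set T) :
  lin_closed V -> (forall i, V (Y i)) -> sigma_family Y A ->
  trig_closure_set V A.
Proof.
move=> Vlin VY; apply: (smallest_sub (trig_closure_set_sigma Vlin)).
by move=> _ [i _ [B mB <-]]; rewrite setTI; exact: trig_closure_set_preimage.
Qed.

Lemma trig_closure_measurable (V : set (T -> R)) f :
  (forall X, V X -> measurable_fun [set: T] X) -> trig_closure V f ->
  measurable_fun [set: T] f.
Proof.
move=> mV; elim=> [X b /mV mX|a g h _ mg _ mh|f_ g M _ mf _ fg].
- by apply: (measurableT_comp (@measurable_sin R)); exact: measurable_funD.
- by apply: measurable_funD => //; exact: measurable_funM.
- exact: (measurable_fun_cvg mf (fun w _ => fg w)).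
Qed.

(** The functional [f |-> E[e f]] vanishes on the generating sines and passes to
    bounded limits by dominated convergence. *)
Lemma trig_closure_orth (V : set (T -> R)) (e f : T -> R) :
  (forall X, V X -> measurable_fun [set: T] X) ->
  P.-integrable [set: T] (EFin \o e) ->
  (forall X b, V X -> \int[P]_w (e w * sin (X w + b)) = 0) ->
  trig_closure V f -> \int[P]_w (e w * f w) = 0.
Proof.
move=> mV ie e0.
have ief g : trig_closure V g ->
    P.-integrable [set: T] (EFin \o (fun w => e w * g w)).
  move=> cg; have [M gM] := trig_closure_bounded cg.
  by apply: (integrable_mul_bounded ie _ gM); exact: trig_closure_measurable cg.
elim=> [X b VX|a g h cg IHg ch IHh|f_ g M cf_ IH fM fg].
- exact: e0.
- have -> : \int[P]_w (e w * (a * g w + h w)) =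
      \int[P]_w (a * (e w * g w) + e w * h w).
    by apply: eq_Rintegral => w _; ring.
  rewrite RintegralD//; last 2 first.
  + apply: (@eq_integrable _ _ _ P setT measurableT
      (fun w => a%:E * (e w * g w)%:E)%E) => //.
    by apply: integrableZl => //; exact: ief.
  + exact: ief.
  by rewrite RintegralZl ?IHg ?IHh ?mulr0 ?addr0//; exact: ief.
- have cv : \int[P]_w (e w * f_ n w) @[n --> \oo] --> \int[P]_w (e w * g w).
    apply: (Rintegral_cvg (g := fun w => `|e w| * `|M|)).
    + move=> n; apply: measurable_funM;
        last exact: trig_closure_measurable (cf_ n).
      by apply/measurable_EFinP; exact: measurable_int ie.
    + by move=> w; apply: cvgM => //; exact: cvg_cst.
    + have ine : P.-integrable [set: T] (EFin \o (fun w => `|e w|)).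
        exact: integrable_norm.
      apply: (integrable_mul_bounded (M := `|M|) ine) => // w.
      by rewrite normr_id.
    + by move=> n w; rewrite normrM ler_wpM2l// (le_trans (fM n w))// ler_norm.
  have cv0 : \int[P]_w (e w * f_ n w) @[n --> \oo] --> (0 : R).
    rewrite (_ : (fun n => _) = fun=> 0); first exact: cvg_cst.
    by apply/funext => n; exact: IH.
  by apply: (cvg_unique _ cv cv0).
Qed.

(** The elements of [H] orthogonal to [e] form a linear space that contains
    [Y]; by [orth_sin] and [trig_closure_orth], [e] integrates to 0 against the
    closure of its sines, which contains the indicator of [A]. *)
Lemma gaussian_orth_integral (H : set (T -> R)) (I : Type) (Y : I -> T -> R)
    (e : T -> R) (A : set T) :
  gaussian_space P H -> H e -> (forall i, H (Y i)) ->
  (forall i, inner P e (Y i) = 0) -> sigma_family Y A ->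
  (\int[P]_(w in A) (e w)%:E = 0)%E.
Proof.
move=> gH He HY eY sA.
pose V := [set W | H W /\ inner P e W = 0].
have L2e := gaussian_space_L2 gH He.
have Vlin : lin_closed V.
  split=> [|a X Z [HX X0] [HZ Z0]].
    split; first exact: gH.1.1.
    rewrite /inner; under eq_Rintegral do rewrite mulr0.
    exact: Rintegral_prob_cst.
  split; first exact: gH.1.2.
  rewrite innerC innerDl//; try exact: (gaussian_space_L2 gH).
  by rewrite ![inner _ _ e]innerC X0 Z0 mulr0 addr0.
have VY i : V (Y i) by split.
have mV X : V X -> measurable_fun [set: T] X.
  by move=> [HX _]; exact: L2_measurable (gaussian_space_L2 gH HX).
have cA := sigma_family_trig_closure_set Vlin VY sA.
have ie := L2_integrable L2e.
have mA : measurable A by apply: sigma_family_measurable sA => i; exact: mV.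
have e0 : \int[P]_w (e w * \1_A w) = 0.
  apply: (trig_closure_orth mV ie _ cA) => X b [HX X0].
  exact: (orth_sin gH).
have ieA : P.-integrable [set: T] (EFin \o (fun w => e w * \1_A w)).
  apply: (integrable_mul_bounded (M := 1) ie); first exact: measurable_indic.
  by move=> w; rewrite indicE; case: (_ \in _); rewrite ?normr1 ?normr0.
have := congr1 EFin e0.
rewrite /Rintegral fineK; last exact: integrable_fin_num.
move=> E; apply: (etrans _ E); rewrite [LHS]integral_mkcond.
apply: eq_integral => w _; rewrite patchE indicE.
by case: ifP => _; rewrite ?mulr1 ?mulr0.
Qed.

End OrthogonalIndependent.

(** * The Gaussian space spanned by two independent families *)

Section Span.
Context (d : measure_display) (T : measurableType d) (R : realType).
Variable P : probability T R.

Definition lspan (I : Type) (X : I -> T -> R) : set (T -> R) :=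
  [set f | exists (s : seq I) (c : I -> R),
     f = fun w => \sum_(i <- s) c i * X i w].

(** Linear combinations over different lists are added by rewriting both over a
    common duplicate-free list. *)
Lemma sum_uniq_count (I : eqType) (r s : seq I) (F : I -> R) :
  uniq r -> {subset s <= r} ->
  \sum_(i <- s) F i = \sum_(i <- r) (count_mem i s)%:R * F i.
Proof.
move=> ur; elim: s => [|x s IH] sr /=.
  by rewrite big_nil big1// => i _; rewrite mul0r.
rewrite big_cons IH; last by move=> y ys; apply: sr; rewrite inE ys orbT.
under [in RHS]eq_bigr do rewrite natrD mulrDl.
rewrite big_split/=; congr (_ + _).
rewrite (bigD1_seq x)//=; last by apply: sr; rewrite mem_head.
rewrite eqxx mul1r big1 ?addr0// => i ix.
by rewrite eq_sym (negbTE ix) mul0r.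
Qed.

Lemma lspan_gen (I : Type) (X : I -> T -> R) i : lspan X (X i).
Proof.
exists [:: i], (fun=> 1); apply/funext => w.
by rewrite big_seq1 mul1r.
Qed.

Lemma lspan0 (I : Type) (X : I -> T -> R) : lspan X (fun=> 0).
Proof. by exists [::], (fun=> 0); apply/funext => w; rewrite big_nil. Qed.

Lemma lspan_lin_closed (I : eqType) (X : I -> T -> R) : lin_closed (lspan X).
Proof.
split=> [|a _ _ [s [c ->]] [t [e ->]]]; first exact: lspan0.
exists (undup (s ++ t)),
  (fun i => a * ((count_mem i s)%:R * c i) + (count_mem i t)%:R * e i).
apply/funext => w.
rewrite (@sum_uniq_count _ (undup (s ++ t)) s) ?undup_uniq//; last first.
  by move=> x xs; rewrite mem_undup mem_cat xs.
rewrite (@sum_uniq_count _ (undup (s ++ t)) t) ?undup_uniq//; last first.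
  by move=> x xs; rewrite mem_undup mem_cat xs orbT.
rewrite mulr_sumr -big_split/=; apply: eq_bigr => i _; ring.
Qed.

Lemma lspan_sigma_family (I : Type) (X : I -> T -> R) f (B : set R) :
  lspan X f -> measurable B -> sigma_family X (f @^-1` B).
Proof.
move=> [s [c ->]] mB.
pose G : set (set T) :=
  \bigcup_(i in [set: I]) preimage_set_system [set: T] (X i) measurable.
pose T' := g_sigma_algebraType G.
have mX i : measurable_fun [set: T'] (X i : T' -> R).
  by move=> _ C mC; rewrite setTI; exact: sigma_family_gen.
have mS : measurable_fun [set: T'] (fun w : T' => \sum_(i <- s) c i * X i w).
  by apply: measurable_sum => i; exact: measurable_funM.
by have := mS measurableT B mB; rewrite setTI.
Qed.

Lemma Rintegral_lin (a : R) f g : L2 P f -> L2 P g ->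
  \int[P]_w (a * f w + g w) = a * \int[P]_w f w + \int[P]_w g w.
Proof.
move=> Lf Lg; rewrite RintegralD ?RintegralZl//; try exact: L2_integrable.
exact: L2_integrable (L2_scale a Lf).
Qed.

Lemma lspan_normal0 (I : Type) (X : I -> T -> R) f :
  jointly_gaussian P X -> (forall i, \int[P]_w X i w = 0) ->
  lspan X f -> exists s, is_normal0 P s f.
Proof.
move=> gX X0.
have nX i : exists s, is_normal0 P s (X i).
  apply: gaussian_mean0_normal0 (X0 i).
  have := gX [:: i] (fun=> 1); congr gaussian.
  by apply/funext => w; rewrite big_seq1 mul1r.
have LX i : L2 P (X i) by have [s] := nX i; exact: is_normal0_L2.
move=> [s [c ->]]; apply: gaussian_mean0_normal0; first exact: gX.
suff [] : L2 P (fun w => \sum_(i <- s) c i * X i w) /\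
  \int[P]_w (\sum_(i <- s) c i * X i w) = 0 by [].
elim: s => [|x s [IHL IHI]].
  have -> : (fun w => \sum_(i <- [::]) c i * X i w) = fun=> 0.
    by apply/funext => w; rewrite big_nil.
  by split; [exact: L2_cst|exact: Rintegral_prob_cst].
have -> : (fun w => \sum_(i <- x :: s) c i * X i w) =
    (fun w => c x * X x w + \sum_(i <- s) c i * X i w).
  by apply/funext => w; rewrite big_cons.
by split; [exact: L2_lin|rewrite Rintegral_lin// X0 IHI mulr0 addr0].
Qed.

Definition addspan (I J : Type) (X : I -> T -> R) (Y : J -> T -> R) :
  set (T -> R) :=
  [set f | exists f1 f2,
     [/\ lspan X f1, lspan Y f2 & f = fun w => f1 w + f2 w]].

Section TwoFamilies.
Variables (I J : eqType) (X : I -> T -> R) (Y : J -> T -> R).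
Hypothesis gX : jointly_gaussian P X.
Hypothesis X0 : forall i, \int[P]_w X i w = 0.
Hypothesis gY : jointly_gaussian P Y.
Hypothesis Y0 : forall i, \int[P]_w Y i w = 0.
Hypothesis XY : independent_families P X Y.

Let indep_lspan f1 f2 : lspan X f1 -> lspan Y f2 -> independent_pair P f1 f2.
Proof. by move=> sf sg A B mA mB; apply: XY; exact: lspan_sigma_family. Qed.

Lemma addspan_lin_closed : lin_closed (addspan X Y).
Proof.
split.
  exists (fun=> 0), (fun=> 0); split; [exact: lspan0|exact: lspan0|].
  by apply/funext => w; rewrite addr0.
move=> a _ _ [f1 [f2 [sf1 sf2 ->]]] [g1 [g2 [sg1 sg2 ->]]].
exists (fun w => a * f1 w + g1 w), (fun w => a * f2 w + g2 w).
split; [exact: (lspan_lin_closed X).2|exact: (lspan_lin_closed Y).2|].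
by apply/funext => w; ring.
Qed.

Lemma addspan_gaussian : gaussian_space P (addspan X Y).
Proof.
split=> [|_ [f1 [f2 [sf1 sf2 ->]]]]; first exact: addspan_lin_closed.
have [s n1] := lspan_normal0 gX X0 sf1.
have [t n2] := lspan_normal0 gY Y0 sf2.
exists (Num.sqrt (s ^+ 2 + t ^+ 2)).
by apply: is_normal0_add => //; exact: indep_lspan.
Qed.

Lemma addspanl i : addspan X Y (X i).
Proof.
exists (X i), (fun=> 0); split; first exact: lspan_gen.
  exact: lspan0.
by apply/funext => w; rewrite addr0.
Qed.

Lemma addspanr j : addspan X Y (Y j).
Proof.
exists (fun=> 0), (Y j); split; last 2 first.
- exact: lspan_gen.
- by apply/funext => w; rewrite add0r.
exact: lspan0.
Qed.

(** The second moment of a sum of independent centred normal variables is the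
    sum of the second moments; polarisation gives the claim. *)
Lemma indep_inner0 i j : inner P (X i) (Y j) = 0.
Proof.
have [s n1] := lspan_normal0 gX X0 (lspan_gen X i).
have [t n2] := lspan_normal0 gY Y0 (lspan_gen Y j).
have n12 := is_normal0_add n1 n2 (indep_lspan (lspan_gen X i) (lspan_gen Y j)).
have L1 := is_normal0_L2 n1; have L2' := is_normal0_L2 n2.
have := is_normal0_inner n12.
rewrite sqr_sqrtr ?addr_ge0 ?sqr_ge0// mulrDl.
rewrite -(is_normal0_inner n1) -(is_normal0_inner n2).
have -> : (fun w => X i w + Y j w) = (fun w => 1 * X i w + Y j w).
  by apply/funext => w; rewrite mul1r.
have L12 := L2_lin 1 L1 L2'.
rewrite innerDl// (innerC P (X i) (fun _ => _)).
rewrite (innerC P (Y j) (fun _ => _)) !innerDl//.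
by rewrite (innerC P (Y j) (X i)); lra.
Qed.

End TwoFamilies.
End Span.

(** * Positive definite matrices and the recursion of the weights *)

Section PositiveDefinite.
Context (R : realType).

Lemma quad_congr (m n : nat) (B : 'M[R]_(n, m)) (A : 'M[R]_m) (x : 'cV[R]_n) :
  x^T *m (B *m A *m B^T) *m x = (B^T *m x)^T *m A *m (B^T *m x).
Proof. by rewrite trmx_mul trmxK !mulmxA. Qed.

Lemma posdefmx_quad_ge0 (n : nat) (A : 'M[R]_n) (x : 'cV[R]_n) :
  posdefmx A -> 0 <= (x^T *m A *m x) 0 0.
Proof.
move=> [_ Ap]; have [->|x0] := eqVneq x 0; first by rewrite mulmx0 mxE.
exact/ltW/Ap.
Qed.

Lemma posdefmx_unit (n : nat) (A : 'M[R]_n) : posdefmx A -> A \in unitmx.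
Proof.
move=> [As Ap]; rewrite unitmxE unitfE; apply/negP => /det0P[v v0 vA].
have vT0 : v^T != 0.
  by apply: contraNneq v0 => /(congr1 trmx); rewrite trmxK trmx0 => ->.
by have := Ap _ vT0; rewrite trmxK vA mul0mx mxE ltxx.
Qed.

Lemma posdefmx_inv (n : nat) (A : 'M[R]_n) : posdefmx A -> posdefmx (invmx A).
Proof.
move=> pA; have uA := posdefmx_unit pA; case: (pA) => As Ap.
have Vs : (invmx A)^T = invmx A by rewrite trmx_inv As.
split=> // x x0.
have -> : x^T *m invmx A *m x = (invmx A *m x)^T *m A *m (invmx A *m x).
  by rewrite trmx_mul Vs !mulmxA mulmxKV.
apply: Ap; apply: contraNneq x0 => /(congr1 (mulmx A)).
by rewrite mulKVmx// mulmx0 => ->.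
Qed.

Lemma posdefmx_congr_add (n k : nat) (B : 'M[R]_(n, k)) (A : 'M[R]_k)
    (C : 'M[R]_n) :
  posdefmx A -> posdefmx C -> posdefmx (B *m A *m B^T + C).
Proof.
move=> pA [Cs Cp]; split.
  by rewrite linearD/= !trmx_mul trmxK pA.1 Cs mulmxA.
move=> x x0; rewrite mulmxDr mulmxDl quad_congr mxE.
by rewrite ltr_wpDl ?Cp// posdefmx_quad_ge0.
Qed.

(** If both [G^T *m x] and [F^T *m x] vanish, then [x^T] annihilates the
    row-free matrix [row_mx F G]. *)
Lemma posdefmx_row_mx_congr (n r : nat) (F : 'M[R]_n) (G : 'M[R]_(n, r))
    (A : 'M[R]_r) (C : 'M[R]_n) :
  row_free (row_mx F G) -> posdefmx A -> posdefmx C ->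
  posdefmx (G *m A *m G^T + F *m C *m F^T).
Proof.
move=> FG pA pC; split.
  by rewrite linearD/= !trmx_mul !trmxK pA.1 pC.1 !mulmxA.
move=> x x0; rewrite mulmxDr mulmxDl !quad_congr mxE.
have gA := posdefmx_quad_ge0 (G^T *m x) pA.
have gC := posdefmx_quad_ge0 (F^T *m x) pC.
have [Gx|Gx] := eqVneq (G^T *m x) 0; last by rewrite ltr_wpDr// pA.2.
have [Fx|Fx] := eqVneq (F^T *m x) 0; last by rewrite ltr_wpDl// pC.2.
have : x^T *m row_mx F G = 0 *m row_mx F G.
  rewrite mul_mx_row mul0mx.
  have -> : x^T *m F = 0 by rewrite -[LHS]trmxK trmx_mul trmxK Fx trmx0.
  have -> : x^T *m G = 0 by rewrite -[LHS]trmxK trmx_mul trmxK Gx trmx0.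
  exact: row_mx0.
move/(row_free_inj FG)/(congr1 trmx); rewrite trmxK trmx0 => /eqP.
by rewrite (negbTE x0).
Qed.

End PositiveDefinite.

Section Weights.
Context (R : realType) (n r q : nat) (c : ssm_coef R n r q).
Hypothesis ok : ssm_coef_ok c.
Local Notation F := (ssm_F c).
Local Notation G := (ssm_G c).
Local Notation H := (ssm_H c).
Local Notation Q := (ssm_Q c).
Local Notation Rm := (ssm_R c).

(** The weight P_(l-1,l), with Pi_0 in the role of P_(-1,0): the claimed error
    covariance at time [l]. *)
Definition weight (l : nat) : 'M[R]_n :=
  if l is j.+1 then pdmm_weight c j else ssm_Pi0 c.

(** The inverse of the error covariance once the measurement at time [l] is
    taken into account. *)
Definition info (l : nat) : 'M[R]_n :=
  (H l)^T *m invmx (Rm l) *m H l + invmx (weight l).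

(** The Kalman gain in information form; it is characterised by the normal
    equation [gain_orth] and equals F W H^T (H W H^T + R)^-1. *)
Definition gain (l : nat) : 'M[R]_(n, q) :=
  F l *m invmx (info l) *m (H l)^T *m invmx (Rm l).

Lemma info_posdef l : posdefmx (weight l) -> posdefmx (info l).
Proof.
move=> pW; have [_ _ pR _] := ok.
have := @posdefmx_congr_add R n q (H l)^T _ _
  (posdefmx_inv (pR l)) (posdefmx_inv pW).
by rewrite trmxK.
Qed.

(** The matrix J_l is block diagonal with blocks Q_l^-1 and [info l]. *)
Lemma weightS l : posdefmx (weight l) ->
  weight l.+1 = G l *m Q l *m (G l)^T + F l *m invmx (info l) *m (F l)^T.
Proof.
move=> pW; have [_ pQ _ _] := ok.
have uQ := posdefmx_unit (pQ l); have uN := posdefmx_unit (info_posdef pW).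
have -> : weight l.+1 = row_mx (G l) (F l) *m invmx (weight_J c l (weight l))
    *m col_mx (G l)^T (F l)^T by case: l {pW uQ uN}.
pose B := block_mx (Q l) 0 0 (invmx (info l)).
have JB : weight_J c l (weight l) *m B = 1%:M.
  rewrite /weight_J -/(info l) mulmx_block !mulmx0 !mul0mx !addr0 !add0r.
  by rewrite mulVmx// mulmxV// -scalar_mx_block.
have [uJ _] := mulmx1_unit JB.
have -> : invmx (weight_J c l (weight l)) = B.
  by rewrite -[RHS](mulKmx uJ) JB mulmx1.
by rewrite mul_row_block !mulmx0 addr0 add0r mul_row_col.
Qed.

Lemma weight_posdef l : posdefmx (weight l).
Proof.
have [FG pQ _ pPi] := ok.
elim: l => [|l IH] //; rewrite weightS//.
by apply: posdefmx_row_mx_congr => //; exact/posdefmx_inv/info_posdef.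
Qed.

(** K H = F N^-1 (H^T R^-1 H) and H^T R^-1 H = N - W^-1, with [N = info l] and
    [W = weight l]. *)
Lemma gain_residual l :
  F l - gain l *m H l = F l *m invmx (info l) *m invmx (weight l).
Proof.
have uN := posdefmx_unit (info_posdef (weight_posdef l)).
have -> : gain l *m H l =
    F l *m invmx (info l) *m ((H l)^T *m invmx (Rm l) *m H l).
  by rewrite /gain !mulmxA.
rewrite -{1}[F l](mulmxKV uN) -mulmxBr; congr (_ *m _).
by rewrite /info addrAC subrr add0r.
Qed.

(** The normal equation: it says that the error at time [l + 1] is orthogonal to
    the measurement at time [l]. *)
Lemma gain_orth l :
  (F l - gain l *m H l) *m (weight l *m (H l)^T) = gain l *m Rm l.
Proof.
have [_ _ pR _] := ok; have uR := posdefmx_unit (pR l).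
have uW := posdefmx_unit (weight_posdef l).
by rewrite gain_residual !mulmxA mulmxKV// /gain mulmxKV.
Qed.

(** By [gain_residual] the first and the third term add up to
    F N^-1 ((F - K H)^T + H^T K^T) = F N^-1 F^T, with [N = info l]. *)
Lemma weight_riccati l :
  (F l - gain l *m H l) *m weight l *m (F l - gain l *m H l)^T
  + G l *m Q l *m (G l)^T + gain l *m Rm l *m (gain l)^T = weight l.+1.
Proof.
have [_ _ pR _] := ok; have uR := posdefmx_unit (pR l).
have uW := posdefmx_unit (weight_posdef l).
rewrite (weightS (weight_posdef l)) addrAC addrC; congr (_ + _).
have -> : (F l - gain l *m H l) *m weight l = F l *m invmx (info l).
  by rewrite gain_residual mulmxKV.
have -> : gain l *m Rm l = F l *m invmx (info l) *m (H l)^T.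
  by rewrite /gain mulmxKV.
rewrite -[_ *m (H l)^T *m _]mulmxA -trmx_mul -mulmxDr -linearD/=.
by rewrite subrK.
Qed.

End Weights.

(** * Second moments of random vectors *)

Section VectorMoments.
Context (d : measure_display) (T : measurableType d) (R : realType).
Variable P : probability T R.

Definition vec_in (S : set (T -> R)) (k : nat) (x : T -> 'cV[R]_k) : Prop :=
  forall i, S (coord x i).

Lemma vec_in_mulmx S k m (A : 'M[R]_(m, k)) x : lin_closed S ->
  vec_in S x -> vec_in S (fun w => A *m x w).
Proof.
move=> Sl Sx i; have := lin_closed_sum (index_enum 'I_k) (A i) Sl Sx.
congr S; apply/funext => w; rewrite /coord mxE.
exact: eq_bigr.
Qed.

Lemma vec_in_add S k (x y : T -> 'cV[R]_k) : lin_closed S ->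
  vec_in S x -> vec_in S y -> vec_in S (fun w => x w + y w).
Proof.
move=> Sl Sx Sy i; have := Sl.2 1 _ _ (Sx i) (Sy i).
by congr S; apply/funext => w; rewrite /coord mxE mul1r.
Qed.

Lemma vec_in_sub S k (x y : T -> 'cV[R]_k) : lin_closed S ->
  vec_in S x -> vec_in S y -> vec_in S (fun w => x w - y w).
Proof.
move=> Sl Sx Sy i; have := Sl.2 (-1) _ _ (Sy i) (Sx i).
by congr S; apply/funext => w; rewrite /coord !mxE mulN1r addrC.
Qed.

Lemma L2_lin_closed : lin_closed (L2 P).
Proof. by split; [exact: L2_cst|move=> a f g; exact: L2_lin]. Qed.

Lemma inner_suml (I : Type) (s : seq I) (a : I -> R) (X : I -> T -> R) Z :
  (forall i, L2 P (X i)) -> L2 P Z ->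
  inner P (fun w => \sum_(i <- s) a i * X i w) Z =
  \sum_(i <- s) a i * inner P (X i) Z.
Proof.
move=> LX LZ; elim: s => [|x s IH].
  rewrite big_nil /inner.
  under eq_Rintegral do rewrite big_nil mul0r.
  exact: Rintegral_prob_cst.
have -> : (fun w => \sum_(i <- x :: s) a i * X i w) =
    (fun w => a x * X x w + \sum_(i <- s) a i * X i w).
  by apply/funext => w; rewrite big_cons.
rewrite innerDl// ?IH ?big_cons//.
exact: lin_closed_sum L2_lin_closed LX.
Qed.

Definition mom2 (k m : nat) (x : T -> 'cV[R]_k) (y : T -> 'cV[R]_m) :
    'M[R]_(k, m) :=
  expectation_mx P (fun w => x w *m (y w)^T).

Lemma mom2E k m (x : T -> 'cV[R]_k) (y : T -> 'cV[R]_m) i j :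
  mom2 x y i j = inner P (coord x i) (coord y j).
Proof.
rewrite mxE unlock /inner; apply: eq_Rintegral => w _.
by rewrite mxE big_ord1 mxE.
Qed.

Lemma mom2T k m (x : T -> 'cV[R]_k) (y : T -> 'cV[R]_m) :
  (mom2 x y)^T = mom2 y x.
Proof. by apply/matrixP => i j; rewrite mxE !mom2E innerC. Qed.

Lemma mom2_mulmx k k' m (A : 'M[R]_(k', k)) (x : T -> 'cV[R]_k)
    (y : T -> 'cV[R]_m) :
  vec_in (L2 P) x -> vec_in (L2 P) y ->
  mom2 (fun w => A *m x w) y = A *m mom2 x y.
Proof.
move=> Lx Ly; apply/matrixP => i j; rewrite mom2E mxE.
have -> : coord (fun w => A *m x w) i =
    (fun w => \sum_(l <- index_enum 'I_k) A i l * coord x l w).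
  by apply/funext => w; rewrite /coord mxE; exact: eq_bigr.
by rewrite inner_suml//; apply: eq_bigr => l _; rewrite mom2E.
Qed.

Lemma mom2_add k m (x x' : T -> 'cV[R]_k) (y : T -> 'cV[R]_m) :
  vec_in (L2 P) x -> vec_in (L2 P) x' -> vec_in (L2 P) y ->
  mom2 (fun w => x w + x' w) y = mom2 x y + mom2 x' y.
Proof.
move=> Lx Lx' Ly; apply/matrixP => i j; rewrite [RHS]mxE !mom2E.
rewrite -[X in X + _]mul1r -innerDl//; congr inner.
by apply/funext => w; rewrite /coord mxE mul1r.
Qed.

Lemma mom2_sub k m (x x' : T -> 'cV[R]_k) (y : T -> 'cV[R]_m) :
  vec_in (L2 P) x -> vec_in (L2 P) x' -> vec_in (L2 P) y ->
  mom2 (fun w => x w - x' w) y = mom2 x y - mom2 x' y.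
Proof.
move=> Lx Lx' Ly; apply/matrixP => i j; rewrite [RHS]mxE [X in _ + X]mxE !mom2E.
rewrite addrC -mulN1r -innerDl//; congr inner.
by apply/funext => w; rewrite /coord !mxE mulN1r addrC.
Qed.

End VectorMoments.

(** * The linear predictor and its error *)

Section Kalman.
Context (d : measure_display) (T : measurableType d) (R : realType).
Variable P : probability T R.
Variables (n r q : nat) (c : ssm_coef R n r q).
Variables (z : nat -> T -> 'cV[R]_n) (y : nat -> T -> 'cV[R]_q).
Variables (u : nat -> T -> 'cV[R]_r) (v : nat -> T -> 'cV[R]_q).
Hypothesis ok : ssm_coef_ok c.
Hypothesis model : gaussian_ssm P c z y u v.
Local Notation F := (ssm_F c).
Local Notation G := (ssm_G c).
Local Notation H := (ssm_H c).
Local Notation K := (gain c).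

Let X0 i : \int[P]_w coord (z 0%N) i w = 0.
Proof.
by have /matrixP/(_ i 0) := ssm_z0_mean model; rewrite !mxE unlock.
Qed.

Let N0 e : \int[P]_w noise_entries u v e w = 0.
Proof.
case: e => -[l i] /=.
- by have /matrixP/(_ i 0) := ssm_u_mean model l; rewrite !mxE unlock.
- by have /matrixP/(_ i 0) := ssm_v_mean model l; rewrite !mxE unlock.
Qed.

Definition model_space : set (T -> R) :=
  addspan (coord (z 0%N)) (noise_entries u v).

Lemma model_space_gaussian : gaussian_space P model_space.
Proof.
apply: addspan_gaussian => //.
- exact: ssm_z0_gaussian model.
- exact: ssm_noise_gaussian model.
- exact: ssm_z0_indep model.
Qed.

Lemma vec_in_L2 k (x : T -> 'cV[R]_k) : vec_in model_space x -> vec_in (L2 P) x.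
Proof.
by move=> Hx i; exact: (gaussian_space_L2 model_space_gaussian (Hx i)).
Qed.

Lemma u_in l : vec_in model_space (u l).
Proof. by move=> i; exact: (addspanr _ _ (inl (l, i))). Qed.

Lemma v_in l : vec_in model_space (v l).
Proof. by move=> i; exact: (addspanr _ _ (inr (l, i))). Qed.

Lemma z_in l : vec_in model_space (z l).
Proof.
elim: l => [|l IH]; first by move=> i; exact: addspanl.
have -> : z l.+1 = (fun w => F l *m z l w + G l *m u l w).
  by apply/funext => w; exact: ssm_state model l w.
apply: vec_in_add; first exact: model_space_gaussian.1.
- exact: vec_in_mulmx model_space_gaussian.1 IH.
- exact: vec_in_mulmx model_space_gaussian.1 (u_in l).
Qed.

Lemma y_in l : vec_in model_space (y l).
Proof.
have -> : y l = (fun w => H l *m z l w + v l w).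
  by apply/funext => w; exact: ssm_measurement model l w.
apply: vec_in_add (v_in l); first exact: model_space_gaussian.1.
exact: vec_in_mulmx model_space_gaussian.1 (z_in l).
Qed.

Fixpoint zlin (l : nat) (w : T) : 'cV[R]_n :=
  if l is j.+1 then F j *m zlin j w + K j *m (y j w - H j *m zlin j w) else 0.

Definition err (l : nat) (w : T) : 'cV[R]_n := z l w - zlin l w.

(** Applied to the span of the past measurements this gives measurability of
    the predictor, applied to [model_space] its Gaussian law. *)
Lemma zlin_closed (S : set (T -> R)) l : lin_closed S ->
  (forall j, (j < l)%N -> vec_in S (y j)) -> vec_in S (zlin l).
Proof.
move=> Sl; elim: l => [|l IH] Sy /=.
  move=> i; have := Sl.1; congr S; apply/funext => w.
  by rewrite /coord /= mxE.
have Sz : vec_in S (zlin l) by apply: IH => j jl; apply: Sy; rewrite ltnS ltnW.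
have Syl := Sy l (ltnSn l).
apply: vec_in_add => //; first exact: vec_in_mulmx.
by apply: vec_in_mulmx => //; apply: vec_in_sub => //; exact: vec_in_mulmx.
Qed.

Lemma zlin_in l : vec_in model_space (zlin l).
Proof.
by apply: zlin_closed => [|j _]; [exact: model_space_gaussian.1|exact: y_in].
Qed.

Lemma err_in l : vec_in model_space (err l).
Proof. exact: vec_in_sub model_space_gaussian.1 (z_in l) (zlin_in l). Qed.

Let Lz l := vec_in_L2 (z_in l).
Let Ly l := vec_in_L2 (y_in l).
Let Lu l := vec_in_L2 (u_in l).
Let Lv l := vec_in_L2 (v_in l).
Let Lzlin l := vec_in_L2 (zlin_in l).
Let Lerr l := vec_in_L2 (err_in l).
Let Lmul k m (A : 'M[R]_(m, k)) (x : T -> 'cV[R]_k) : vec_in (L2 P) x ->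
  vec_in (L2 P) (fun w => A *m x w).
Proof. exact: vec_in_mulmx (L2_lin_closed P). Qed.

Lemma errS l w : err l.+1 w =
  (F l - K l *m H l) *m err l w + (G l *m u l w - K l *m v l w).
Proof.
rewrite /err /= (ssm_state model) (ssm_measurement model).
rewrite mulmxBl !mulmxBr !mulmxDr !mulmxA.
move: (F l *m z l w) (G l *m u l w) (K l *m H l *m z l w) (K l *m v l w)
  (F l *m zlin l w) (K l *m H l *m zlin l w) => a1 a2 a3 a4 a5 a6.
by apply/matrixP => i j; rewrite !mxE; ring.
Qed.

Lemma mom2_errS l m (t : T -> 'cV[R]_m) : vec_in (L2 P) t ->
  mom2 P (err l.+1) t = (F l - K l *m H l) *m mom2 P (err l) t +
    (G l *m mom2 P (u l) t - K l *m mom2 P (v l) t).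
Proof.
move=> Lt; rewrite (_ : err l.+1 = fun w =>
  (F l - K l *m H l) *m err l w + (G l *m u l w - K l *m v l w)); last first.
  by apply/funext => w; exact: errS.
rewrite mom2_add//; last 2 first.
- exact: Lmul.
- by apply: vec_in_sub; [exact: L2_lin_closed|exact: Lmul|exact: Lmul].
by rewrite mom2_sub ?mom2_mulmx//; exact: Lmul.
Qed.

Lemma mom2_z0_noise l :
  mom2 P (z 0%N) (u l) = 0 /\ mom2 P (z 0%N) (v l) = 0.
Proof.
have h i e := @indep_inner0 _ _ _ P _ _ _ _ (ssm_z0_gaussian model) X0
  (ssm_noise_gaussian model) N0 (ssm_z0_indep model) i e.
split; apply/matrixP => i j; rewrite mom2E mxE.
- exact: (h i (inl (l, j))).
- exact: (h i (inr (l, j))).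
Qed.

Lemma mom2_z_u l j : (l <= j)%N -> mom2 P (z l) (u j) = 0.
Proof.
elim: l => [_|l IH lj]; first exact: (mom2_z0_noise j).1.
rewrite (_ : z l.+1 = fun w => F l *m z l w + G l *m u l w); last first.
  by apply/funext => w; exact: ssm_state model l w.
rewrite mom2_add ?mom2_mulmx ?IH ?mulmx0 ?add0r ?(ltnW lj)//; try exact: Lmul.
by rewrite [mom2 _ _ _](ssm_u_cov model) ltn_eqF// mulr0n mulmx0.
Qed.

Lemma mom2_z_v l j : mom2 P (z l) (v j) = 0.
Proof.
elim: l => [|l IH]; first exact: (mom2_z0_noise j).2.
rewrite (_ : z l.+1 = fun w => F l *m z l w + G l *m u l w); last first.
  by apply/funext => w; exact: ssm_state model l w.
rewrite mom2_add ?mom2_mulmx ?IH ?mulmx0 ?add0r//; try exact: Lmul.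
by rewrite [mom2 _ _ _](ssm_uv_cov model) mulmx0.
Qed.

Lemma mom2_y l m (t : T -> 'cV[R]_m) : vec_in (L2 P) t ->
  mom2 P (y l) t = H l *m mom2 P (z l) t + mom2 P (v l) t.
Proof.
move=> Lt; rewrite (_ : y l = fun w => H l *m z l w + v l w); last first.
  by apply/funext => w; exact: ssm_measurement model l w.
by rewrite mom2_add ?mom2_mulmx//; exact: Lmul.
Qed.

Lemma mom2_vu l j : mom2 P (v l) (u j) = 0.
Proof. by rewrite -mom2T [mom2 _ _ _](ssm_uv_cov model) trmx0. Qed.

Lemma mom2_y_u l j : (l <= j)%N -> mom2 P (y l) (u j) = 0.
Proof. by move=> lj; rewrite mom2_y// mom2_z_u// mulmx0 add0r mom2_vu. Qed.

Lemma mom2_y_v l j : mom2 P (y l) (v j) = ssm_R c l *+ (l == j).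
Proof.
by rewrite mom2_y// mom2_z_v mulmx0 add0r [mom2 _ _ _](ssm_v_cov model).
Qed.

(** The predictor is a linear combination of the past measurements. *)
Lemma mom2_zlin l m (t : T -> 'cV[R]_m) : vec_in (L2 P) t ->
  (forall j, (j < l)%N -> mom2 P (y j) t = 0) -> mom2 P (zlin l) t = 0.
Proof.
move=> Lt; elim: l => [|l IH] yt.
  apply/matrixP => i j; rewrite mom2E mxE /inner.
  under eq_Rintegral do rewrite /coord /= mxE mul0r.
  exact: Rintegral_prob_cst.
have zt : mom2 P (zlin l) t = 0.
  by apply: IH => j jl; apply: yt; rewrite ltnS ltnW.
rewrite (_ : zlin l.+1 = fun w =>
  F l *m zlin l w + K l *m (y l w - H l *m zlin l w))//.
have Lr : vec_in (L2 P) (fun w => y l w - H l *m zlin l w).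
  by apply: vec_in_sub => //; [exact: L2_lin_closed|exact: Lmul].
rewrite mom2_add//; last 2 first.
- exact: Lmul.
- exact: Lmul.
rewrite !mom2_mulmx// mom2_sub//; last exact: Lmul.
by rewrite mom2_mulmx// zt (yt l)// !mulmx0 subrr mulmx0 addr0.
Qed.

Lemma mom2_err_u l j : (l <= j)%N -> mom2 P (err l) (u j) = 0.
Proof.
move=> lj; rewrite mom2_sub// mom2_z_u// mom2_zlin ?subrr// => k kl.
by apply: mom2_y_u; rewrite (leq_trans (ltnW kl)).
Qed.

Lemma mom2_err_v l j : (l <= j)%N -> mom2 P (err l) (v j) = 0.
Proof.
move=> lj; rewrite mom2_sub// mom2_z_v mom2_zlin ?subrr// => k kl.
by rewrite mom2_y_v ltn_eqF ?mulr0n// (leq_trans kl).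
Qed.

(** Both facts are proved by one induction: orthogonality to the past gives
    E[err zlin^T] = 0, which is needed to evaluate E[err y^T] at the new
    measurement. *)
Lemma mom2_err l : mom2 P (err l) (err l) = weight c l /\
  forall j, (j < l)%N -> mom2 P (err l) (y j) = 0.
Proof.
elim: l => [|l [IHe IHy]].
  split=> //.
  have -> : err 0 = z 0%N by apply/funext => w; rewrite /err /= subr0.
  exact: ssm_z0_cov model.
have ez : mom2 P (err l) (zlin l) = 0.
  rewrite -mom2T mom2_zlin ?trmx0// => j jl.
  by rewrite -mom2T IHy// trmx0.
split.
- have [_ pQ pR _] := ok.
  have -> : mom2 P (err l.+1) (err l.+1) =
    (F l - K l *m H l) *m ((F l - K l *m H l) *m weight c l)^T +
    (G l *m (G l *m ssm_Q c l)^T + K l *m (K l *m ssm_R c l)^T).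
    rewrite mom2_errS//; congr (_ *m _ + _).
      rewrite -mom2T mom2_errS// IHe.
      rewrite -(mom2T P (err l) (u l)) mom2_err_u// -(mom2T P (err l) (v l)).
      by rewrite mom2_err_v// !trmx0 !mulmx0 subrr addr0.
    rewrite -(mom2T P (err l.+1) (u l)) -(mom2T P (err l.+1) (v l)).
    rewrite !mom2_errS//.
    rewrite mom2_err_u// mom2_err_v// mom2_vu.
    rewrite [mom2 P (u l) (v l)](ssm_uv_cov model).
    rewrite [mom2 P (u l) (u l)](ssm_u_cov model).
    rewrite [mom2 P (v l) (v l)](ssm_v_cov model).
    rewrite eqxx !mulr1n !mulmx0 !add0r subr0.
    by rewrite linearN/= mulmxN opprK.
  rewrite (trmx_mul _ (weight c l)) (trmx_mul (G l)).
  rewrite (trmx_mul (K l) (ssm_R c l)).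
  rewrite (pQ l).1 (pR l).1 (weight_posdef ok l).1 !mulmxA addrA.
  by rewrite weight_riccati.
- move=> j; rewrite ltnS leq_eqVlt => /predU1P[->|jl].
    rewrite mom2_errS//.
    have -> : mom2 P (u l) (y l) = 0 by rewrite -mom2T mom2_y_u// trmx0.
    have -> : mom2 P (v l) (y l) = ssm_R c l.
      rewrite -mom2T mom2_y_v eqxx mulr1n.
      by have [_ _ pR _] := ok; have [] := pR l.
    have -> : mom2 P (err l) (y l) = weight c l *m (H l)^T.
      rewrite -mom2T mom2_y// -(mom2T P (err l) (v l)) mom2_err_v// trmx0 addr0.
      rewrite trmx_mul mom2T; congr (_ *m _).
      have -> : z l = (fun w => err l w + zlin l w).
        by apply/funext => w; rewrite /err subrK.
      rewrite -mom2T mom2_add// IHe -(mom2T P (err l)) ez trmx0 addr0.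
      by rewrite (weight_posdef ok l).1.
    by rewrite (gain_orth ok) mulmx0 sub0r subrr.
  rewrite mom2_errS// IHy//.
  have -> : mom2 P (u l) (y j) = 0 by rewrite -mom2T mom2_y_u ?trmx0// ltnW.
  have -> : mom2 P (v l) (y j) = 0.
    by rewrite -mom2T mom2_y_v ltn_eqF// mulr0n trmx0.
  by rewrite !mulmx0 subrr addr0.
Qed.

End Kalman.

(** * The linear predictor as a conditional expectation *)

Section ConditionalExpectation.
Context (d : measure_display) (T : measurableType d) (R : realType).
Variable P : probability T R.
Variables (I : Type) (Y : I -> T -> R).
Hypothesis mY : forall i, measurable_fun [set: T] (Y i).

Lemma sigma_family_lt (f g : T -> R) :
  (forall B : set R, measurable B -> sigma_family Y (f @^-1` B)) ->
  (forall B : set R, measurable B -> sigma_family Y (g @^-1` B)) ->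
  sigma_family Y [set w | f w < g w].
Proof.
move=> sf sg.
pose T' := g_sigma_algebraType
  (\bigcup_(i in [set: I]) preimage_set_system [set: T] (Y i) measurable).
have mf : measurable_fun [set: T'] (f : T' -> R).
  by move=> _ C mC; rewrite setTI; exact: sf.
have mg : measurable_fun [set: T'] (g : T' -> R).
  by move=> _ C mC; rewrite setTI; exact: sg.
have mt : measurable [set true] by [].
by have := measurable_fun_ltr mf mg measurableT mt; rewrite setTI.
Qed.

(** The event where [g < f] belongs to the conditioning sigma-algebra, and the
    integral of the positive function f - g over it is 0. *)
Lemma cond_expectation_le X f g :
  is_cond_expectation P (sigma_family Y) X f ->
  is_cond_expectation P (sigma_family Y) X g ->
  {ae P, forall w, f w <= g w}.
Proof.
move=> [sf iX if_ Ef] [sg _ ig Eg].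
pose A := [set w | g w < f w].
have sA : sigma_family Y A by exact: sigma_family_lt.
have mA := sigma_family_measurable mY sA.
have ifA := integrableS measurableT mA (@subsetT _ _) if_.
have igA := integrableS measurableT mA (@subsetT _ _) ig.
have ifg : P.-integrable A (EFin \o (fun w => f w - g w)).
  have := integrableB mA ifA igA.
  by apply: eq_integrable.
have I0 : (\int[P]_(w in A) `|(f w - g w)%:E|)%E = 0%E.
  transitivity (\int[P]_(w in A) ((f w)%:E - (g w)%:E))%E.
    apply: eq_integral => w; rewrite inE /= => fg.
    by rewrite ger0_norm ?EFinB// subr_ge0 ltW.
  rewrite integralB//= Ef// Eg// subee//.
  rewrite -Eg//; exact: integrable_fin_num.
have mfg := measurable_int _ ifg.
have /(ae_eq_integral_abs P mA mfg) := I0.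
apply: filterS => w h; rewrite leNgt; apply/negP => gf.
by have [] := h gf => /eqP; rewrite subr_eq0 gt_eqF.
Qed.

Lemma cond_expectation_unique X f g :
  is_cond_expectation P (sigma_family Y) X f ->
  is_cond_expectation P (sigma_family Y) X g ->
  {ae P, forall w, f w = g w}.
Proof.
move=> cf cg.
have h1 := cond_expectation_le cf cg; have h2 := cond_expectation_le cg cf.
apply: filterS2 h1 h2 => w fg gf.
by apply/eqP; rewrite eq_le fg gf.
Qed.

End ConditionalExpectation.

Section KalmanPredictor.
Context (d : measure_display) (T : measurableType d) (R : realType).
Variable P : probability T R.
Variables (n r q : nat) (c : ssm_coef R n r q).
Variables (z : nat -> T -> 'cV[R]_n) (y : nat -> T -> 'cV[R]_q).
Variables (u : nat -> T -> 'cV[R]_r) (v : nat -> T -> 'cV[R]_q).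
Hypothesis ok : ssm_coef_ok c.
Hypothesis model : gaussian_ssm P c z y u v.

Local Notation past l :=
  (fun ji : 'I_l.+1 * 'I_q => coord (y ji.1) ji.2).

Lemma past_measurable l i : measurable_fun [set: T] (past l i).
Proof. exact: L2_measurable (vec_in_L2 model (y_in model i.1) i.2). Qed.

(** The difference z - zlin is an element of the Gaussian space orthogonal to
    the past measurements, so it integrates to 0 over past events. *)
Lemma zlin_cond_expectation l i :
  is_cond_expectation P (past_measurements y l) (coord (z l.+1) i)
    (coord (zlin c y l.+1) i).
Proof.
have Lz := vec_in_L2 model (z_in model l.+1).
have Lzl := vec_in_L2 model (zlin_in model l.+1).
split.
- move=> B mB; apply: lspan_sigma_family mB.
  suff : vec_in (lspan (past l)) (zlin c y l.+1) by exact.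
  apply: zlin_closed; first exact: lspan_lin_closed.
  by move=> j jl k; exact: (lspan_gen (past l) (Ordinal jl, k)).
- exact: L2_integrable (Lz i).
- exact: L2_integrable (Lzl i).
- move=> A sA.
  have mA := sigma_family_measurable (past_measurable (l := l)) sA.
  have e0 : (\int[P]_(w in A) (coord (err c z y l.+1) i w)%:E = 0)%E.
    apply: (gaussian_orth_integral (model_space_gaussian model) _ _ _ sA).
    + exact: (err_in model).
    + by move=> ji; exact: (y_in model ji.1 ji.2).
    + move=> [j k] /=.
      have := (mom2_err ok model l.+1).2 j (ltn_ord j).
      by move/matrixP => /(_ i k); rewrite mom2E mxE.
  have Le := vec_in_L2 model (err_in model l.+1).
  have S k (x : T -> 'cV[R]_k) (j : 'I_k) : vec_in (L2 P) x ->
     P.-integrable A (EFin \o coord x j).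
    by move=> Lx; apply: (integrableS measurableT) => //; exact: L2_integrable.
  transitivity (\int[P]_(w in A) ((coord (err c z y l.+1) i w)%:E +
      (coord (zlin c y l.+1) i w)%:E))%E.
    by rewrite integralD ?e0 ?add0e//; exact: S.
  apply: eq_integral => w _; rewrite -EFinD /coord; congr _%:E.
  by rewrite /err !mxE subrK.
Qed.

(** By uniqueness of conditional expectations the errors of [zhat] and of [zlin]
    agree almost surely, entry by entry. *)
Lemma kalman_cov_weight (zhat : nat -> T -> 'cV[R]_n) l :
  is_kalman_predictor P z y zhat ->
  kalman_cov P z zhat l.+1 = weight c l.+1.
Proof.
move=> [_ zhatE]; rewrite -(mom2_err ok model l.+1).1.
pose ehat w := z l.+1 w - zhat l.+1 w.
rewrite -[LHS]/(mom2 P ehat ehat).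
have iz k : is_cond_expectation P (past_measurements y l) (coord (z l.+1) k)
   (coord (zhat l.+1) k) by exact: zhatE.
have mzhat k : measurable_fun [set: T] (coord (zhat l.+1) k).
  by have [_ _ /measurable_int/measurable_EFinP] := iz k.
have mz k : measurable_fun [set: T] (coord (z l.+1) k).
  exact: L2_measurable (vec_in_L2 model (z_in model l.+1) k).
have me k : measurable_fun [set: T] (coord (err c z y l.+1) k).
  exact: L2_measurable (vec_in_L2 model (err_in model l.+1) k).
have mehat k : measurable_fun [set: T] (coord ehat k).
  have := measurable_funB (mz k) (mzhat k).
  by congr measurable_fun; apply/funext => w; rewrite /Defs.coord !mxE.
have ae k : {ae P, forall w, coord ehat k w = coord (err c z y l.+1) k w}.
  have := cond_expectation_unique (past_measurable (l := l)) (iz k)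
    (zlin_cond_expectation l k).
  by apply: filterS => w; rewrite /Defs.coord !mxE => ->.
apply/matrixP => i j; rewrite !mom2E; congr fine.
apply: ae_eq_integral => //.
- by apply/measurable_EFinP; exact: measurable_funM.
- by apply/measurable_EFinP; exact: measurable_funM.
- by apply: filterS2 (ae i) (ae j) => w -> ->.
Qed.

End KalmanPredictor.

Theorem proposition1 (d : measure_display) (T : measurableType d)
    (R : realType) (P : probability T R) (n r q : nat)
    (c : ssm_coef R n r q)
    (z : nat -> T -> 'cV[R]_n) (y : nat -> T -> 'cV[R]_q)
    (u : nat -> T -> 'cV[R]_r) (v : nat -> T -> 'cV[R]_q)
    (zhat : nat -> T -> 'cV[R]_n) (l : nat) :
  ssm_coef_ok c ->
  gaussian_ssm P c z y u v ->
  is_kalman_predictor P z y zhat ->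
  forall i : nat, (i <= l)%N ->
    kalman_cov P z zhat i.+1 = pdmm_weight c i.
Proof.
by move=> ok model pred i _; exact: kalman_cov_weight ok model _ _ pred.
Qed.
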